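(* Let $n\ge2$ and let $\mu$ be a locally finite Borel measure on $\mathbb{R}^n$. Then there is a constant $C>0$, independent of $f$, such that $$\|\mathrm{I}_1f\|_{L^1(\mu)}\le C\,\|\mathbf{R}f\|_{L^1(\mathrm{M}_1\mu)}\qquad\text{for all } f\in C_c^\infty(\mathbb{R}^n).$$
   Context: A locally finite Borel measure on $\mathbb{R}^n$ is a positive Borel measure $\mu$ with $\mu(K)<\infty$ for every compact $K$. $\mathcal{L}$ denotes Lebesgue measure, and $\mathrm{M}_1\mu(x)=\sup_{r>0} r\,\mu(B_r(x))/\mathcal{L}(B_r(x))\in[0,\infty]$. $\|g\|_{L^1(w)}=\int|g|\,w\,dx$ for a weight $w$ (with $0\cdot\infty=0$). The Riesz potential of order $0<\alpha<n$ is $\mathrm{I}_\alpha f(x)=\frac1{\gamma(\alpha)}\int_{\mathbb{R}^n}\frac{f(y)}{|x-y|^{n-\alpha}}\,dy$ with $\gamma(\alpha)=2^\alpha\pi^{n/2}\Gamma(\alpha/2)/\Gamma((n-\alpha)/2)$. The vector-valued Riesz transform is $\mathbf{R}f=-\nabla \mathrm{I}_1f$, i.e. $\mathbf{R}f(x)=\mathrm{p.v.}\int_{\mathbb{R}^n}\frac{c_n\,y}{|y|^{n+1}}f(x-y)\,dy$. *)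

(* Defs.v *)
From HB Require Import structures.
From mathcomp Require Import all_boot all_order all_algebra.
From mathcomp Require Import all_classical all_reals all_analysis.
From mathcomp Require Import measurable_realfun.

Set Implicit Arguments.
Unset Strict Implicit.
Unset Printing Implicit Defensive.

Import Order.TTheory GRing.Theory Num.Theory.
Import numFieldNormedType.Exports.

Local Open Scope classical_set_scope.
Local Open Scope ring_scope.

(* ['rV[R]_n] with its Borel sigma-algebra. *)
Notation borelRV R n := (g_sigma_algebraType (open : set_system 'rV[R]_n)).

Section borel.
Context {R : realType}.

Lemma open_rV_bigcup_ball n (U : set 'rV[R]_n) : open U ->
  U = \bigcup_(p in [set p : 'rV[rat]_n * nat |
                     ball (map_mx ratr p.1 : 'rV[R]_n) p.2.+1%:R^-1 `<=` U])
        ball (map_mx ratr p.1 : 'rV[R]_n) p.2.+1%:R^-1.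
Proof.
move=> oU; apply/seteqP; split => [x Ux|x [p pU]]; last exact: pU.
have /nbhs_ballP[e /= e0 eU] : nbhs x U by exact: open_nbhs_nbhs.
pose k := Num.truncn (2 / e).
have ke : k.+1%:R^-1 < e / 2 :> R.
  by rewrite -[e / 2]invrK ltf_pV2 ?posrE ?invr_gt0 ?divr_gt0// invf_div truncnS_gt.
have k0 : 0 < k.+1%:R^-1 :> R by rewrite invr_gt0.
have /choice[q xq] (i : 'I_n) : exists q, ball (x ord0 i) k.+1%:R^-1 (ratr q).
  have /rat_in_itvoo[q] : x ord0 i - k.+1%:R^-1 < x ord0 i + k.+1%:R^-1.
    by rewrite ltrBlDr -addrA ltrDl addr_gt0.
  by rewrite in_itv/= => qx; exists q; rewrite /ball/= ltr_distlC.
have {}xq : ball x k.+1%:R^-1 (map_mx ratr (\row_i q i) : 'rV[R]_n).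
  by split => // i j; rewrite !mxE (ord1 i); exact: xq.
exists (\row_i q i, k) => /=; last exact: ball_sym.
move=> y qy; apply: eU; apply: (@le_ball _ _ _ (k.+1%:R^-1 + k.+1%:R^-1)).
  by rewrite [e]splitr lerD// ltW.
exact: ball_triangle xq qy.
Qed.

Lemma measurable_fun_borelRV d (T : measurableType d) n (f : T -> borelRV R n) :
  (forall i, measurable_fun [set: T]
     ((fun x => f x ord0 i) : T -> measurableTypeR R)) ->
  measurable_fun [set: T] f.
Proof.
move=> mf; apply: (@measurability _ _ T (borelRV R n) setT f (open : set_system 'rV[R]_n)) => //.
move=> _ [U oU <-]; rewrite setTI (open_rV_bigcup_ball oU) preimage_bigcup.
rewrite bigcup_mkcond; apply: countable_bigcupT_measurable => [|p].
  exact: countableP.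
case: ifPn => // _.
set c := map_mx _ _; set e := _^-1.
rewrite [X in measurable X](_ : _ = \bigcap_(i in [set: 'I_n])
    ((fun x => f x ord0 i) @^-1` ball (c ord0 i) e)).
  apply: fin_bigcap_measurable => // i _; rewrite -[X in measurable X]setTI.
  by apply: mf => //; apply: open_measurable; exact: ball_open.
apply/seteqP; split => [x [e0 cx] i _|x cx]; first exact: cx.
by split => [|i j]; [rewrite invr_gt0|rewrite ord1; exact: cx].
Qed.

Lemma measurable_coord n (i : 'I_n) :
  measurable_fun [set: borelRV R n]
    ((fun v : 'rV[R]_n => v ord0 i) : borelRV R n -> measurableTypeR R).
Proof.
apply: (measurability _ (RGenOpens.measurableE R)).
move=> _ [_ [a [b ->]] <-]; rewrite setTI; apply: sub_sigma_algebra.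
by move/continuousP : (@coord_continuous R 1 n ord0 i); apply; exact: interval_open.
Qed.

Definition consRV n (p : measurableTypeR R * borelRV R n) : borelRV R n.+1 :=
  row_mx (p.1)%:M (p.2 : 'rV[R]_n) : 'rV[R]_(1 + n).

Definition unconsRV n (v : borelRV R n.+1) : measurableTypeR R * borelRV R n :=
  (v ord0 ord0, rsubmx (v : 'rV[R]_(1 + n))).

Lemma consRVl n (p : measurableTypeR R * borelRV R n) (j : 'I_1) :
  consRV p ord0 (lshift n j) = p.1.
Proof.
by apply: etrans (row_mxEl p.1%:M (p.2 : 'rV[R]_n) _ _) _; rewrite mxE (ord1 j).
Qed.

Lemma consRVr n (p : measurableTypeR R * borelRV R n) (j : 'I_n) :
  consRV p ord0 (rshift 1 j) = p.2 ord0 j.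
Proof. exact: row_mxEr. Qed.

Lemma consRVK n : cancel (@consRV n) (@unconsRV n).
Proof.
move=> [x v]; rewrite /unconsRV /consRV/= row_mxKr; congr pair.
rewrite (_ : ord0 = lshift n ord0 :> 'I_(1 + n)); last exact: val_inj.
exact: (consRVl (x, v)).
Qed.

Lemma measurable_consRV n : measurable_fun [set: _] (@consRV n).
Proof.
apply: measurable_fun_borelRV => i.
case: (@split_ordP 1 n i) => j ->.
  under eq_fun do rewrite consRVl.
  exact: measurable_fst.
under eq_fun do rewrite consRVr.
exact: (measurableT_comp (measurable_coord j) measurable_snd).
Qed.

Lemma measurable_unconsRV n : measurable_fun [set: _] (@unconsRV n).
Proof.
apply/measurable_fun_pairP; split; first exact: measurable_coord.
apply: measurable_fun_borelRV => i; rewrite /unconsRV/=.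
by under eq_fun do rewrite mxE; exact: measurable_coord.
Qed.

End borel.

Section lebesgue_step.
Context {R : realType} (n : nat).
Variable m : {sigma_finite_measure set (borelRV R n) -> \bar R}.

Definition lebesgueRV_step : set (borelRV R n.+1) -> \bar R :=
  pushforward ((@lebesgue_measure R) \x m)%E (@consRV R n).

Let lebesgueRV_step0 : lebesgueRV_step set0 = 0%E.
Proof. by rewrite /lebesgueRV_step /pushforward preimage_set0 measure0. Qed.

Let lebesgueRV_step_ge0 A : (0 <= lebesgueRV_step A)%E.
Proof. by apply: measure_ge0 => //; exact: measurable_consRV. Qed.

Let lebesgueRV_step_sigma_additive : semi_sigma_additive lebesgueRV_step.
Proof.
by apply: measure_semi_sigma_additive => //; exact: measurable_consRV.
Qed.

HB.instance Definition _ := isMeasure.Build _ _ _ lebesgueRV_step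
  lebesgueRV_step0 lebesgueRV_step_ge0 lebesgueRV_step_sigma_additive.

Let lebesgueRV_step_sigma_finite : sigma_finite setT lebesgueRV_step.
Proof.
have /sigma_finiteP[F [TF ndF Foo]] := sigma_finiteT (@lebesgue_measure R).
have /sigma_finiteP[G [TG ndG Goo]] := sigma_finiteT m.
exists (fun k => @unconsRV R n @^-1` (F k `*` G k)).
  rewrite -preimage_bigcup (_ : \bigcup_k _ = setT) ?preimage_setT//.
  rewrite -subTset => -[x y] _.
  have [k _ Fkx] : (\bigcup_k F k) x by rewrite -TF.
  have [l _ Gly] : (\bigcup_k G k) y by rewrite -TG.
  exists (maxn k l) => //; split => /=.
  - by move: x Fkx; exact/subsetPset/ndF/leq_maxl.
  - by move: y Gly; exact/subsetPset/ndG/leq_maxr.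
move=> k; have [mFk Fkoo] := Foo k; have [mGk Gkoo] := Goo k; split.
  rewrite -[X in measurable X]setTI; apply: measurable_unconsRV => //.
  exact: measurableX.
rewrite /lebesgueRV_step /pushforward -comp_preimage.
rewrite (_ : _ \o _ = id); last by apply/funext => p; exact: consRVK.
rewrite preimage_id product_measure1E// lte_mul_pinfty// ge0_fin_numE//.
Qed.

HB.instance Definition _ := Measure_isSigmaFinite.Build _ _ _ lebesgueRV_step
  lebesgueRV_step_sigma_finite.

End lebesgue_step.

(* Lebesgue measure on R^n as the n-fold product of [lebesgue_measure]. *)
Fixpoint lebesgueRV (R : realType) (n : nat) :
    {sigma_finite_measure set (borelRV R n) -> \bar R} :=
  match n with
  | 0 => [the {sigma_finite_measure set (borelRV R 0) -> \bar R} of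
            @dirac _ (borelRV R 0) (0 : 'rV[R]_0) R]
  | k.+1 => [the {sigma_finite_measure set (borelRV R k.+1) -> \bar R} of
               lebesgueRV_step (lebesgueRV R k)]
  end.

Lemma lebesgueRV_box (R : realType) n (A : 'I_n -> set (measurableTypeR R)) :
  (forall i, measurable (A i)) ->
  lebesgueRV R n [set v : 'rV[R]_n | forall i, A i (v ord0 i)] =
  (\prod_(i < n) @lebesgue_measure R (A i))%E.
Proof.
elim: n A => [|n ih] A mA.
  by rewrite big_ord0 /= diracE mem_set// => -[].
rewrite big_ord_recl -(ih (fun i => A (lift ord0 i)))//=.
rewrite /lebesgueRV_step /pushforward.
have -> : @consRV R n @^-1` [set v | forall i, A i (v ord0 i)] =
    A ord0 `*` [set v : 'rV[R]_n | forall i, A (lift ord0 i) (v ord0 i)].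
  have l0 : ord0 = lshift n ord0 :> 'I_(1 + n) by exact: val_inj.
  have li (i : 'I_n) : lift ord0 i = rshift 1 i :> 'I_(1 + n) by exact: val_inj.
  apply/seteqP; split => [p Ap|p [A0 Ap] i]/=.
    split => [|i]/=.
      by have := Ap ord0; rewrite {2}l0 (consRVl p ord0).
    by have := Ap (lift ord0 i); rewrite {2}li (consRVr p i).
  case: (@split_ordP 1 n i) => j ->.
    by rewrite (consRVl p j) (ord1 j) -l0.
  by rewrite (consRVr p j) -li; exact: Ap.
rewrite product_measure1E//.
rewrite [X in measurable X](_ : _ = \bigcap_(i in [set: 'I_n])
    ((fun v : borelRV R n => v ord0 i) @^-1` A (lift ord0 i))).
  apply: fin_bigcap_measurable => // i _; rewrite -[X in measurable X]setTI.
  exact: measurable_coord.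
by apply/seteqP; split => [v Av i _|v Av i]; exact: Av.
Qed.

Section operators.
Context {R : realType} {n : nat}.
Local Notation lebesgue := (lebesgueRV R n).

(* The library norm on ['rV[R]_n] is the sup norm; the norm and the balls
   below are the Euclidean ones. *)
Definition enorm (x : 'rV[R]_n) : R := Num.sqrt (\sum_i x ord0 i ^+ 2).

Definition eball (x : 'rV[R]_n) (r : R) : set 'rV[R]_n :=
  [set y | enorm (x - y) < r].

Definition locally_finite_measure
    (mu : {measure set (borelRV R n) -> \bar R}) : Prop :=
  forall K : set 'rV[R]_n, compact K -> (mu K < +oo)%E.

Definition maximal1 (mu : set (borelRV R n) -> \bar R) (x : 'rV[R]_n) : \bar R :=
  ereal_sup [set (r%:E * mu (eball x r) / lebesgue (eball x r))%E
            | r in `]0, +oo[%classic].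

Definition partial (i : 'I_n) (f : 'rV[R]_n -> R) : 'rV[R]_n -> R :=
  'D_(delta_mx ord0 i) f.

Fixpoint Ck (k : nat) (f : 'rV[R]_n -> R) : Prop :=
  match k with
  | 0 => continuous f
  | k'.+1 => continuous f /\ forall i : 'I_n,
      (forall x, derivable f x (delta_mx ord0 i)) /\ Ck k' (partial i f)
  end.

Definition test_function (f : 'rV[R]_n -> R) : Prop :=
  (forall k, Ck k f) /\ compact (closure [set x | f x != 0]).

Definition Gamma (s : R) : R :=
  \int[lebesgue_measure]_(t in `]0, +oo[) (t `^ (s - 1) * expR (- t)).

Definition riesz_constant (a : R) : R :=
  2 `^ a * pi `^ (n%:R / 2) * Gamma (a / 2) / Gamma ((n%:R - a) / 2).

Definition riesz_potential (a : R) (f : 'rV[R]_n -> R) (x : 'rV[R]_n) : R :=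
  (riesz_constant a)^-1 * \int[lebesgue]_y (f y / enorm (x - y) `^ (n%:R - a)).

Definition riesz_transform (f : 'rV[R]_n -> R) (x : 'rV[R]_n) : 'rV[R]_n :=
  - \row_i partial i (riesz_potential 1 f) x.

End operators.

(* Main.v *)
(** Let [u = I_1 f]. On a dyadic grid of mesh [h], the classical
    "boxing" argument (stop at the maximal dyadic cubes where a level set of [u]
    has large density and apply the relative isoperimetric inequality in them)
    gives [sum_q mu(q) a(q) <= C sum_q w(q) |grad a|(q)], where
    [w(q) = max_j mu(Q_j) / 2^(j(n-1))] runs over the dyadic ancestors [Q_j] of [q],
    so that [w(q) <= C h^(n-1) M_1 mu(z)] for every [z] in the cell [q]. Apply it
    to [a = (|u| - e)^+] sampled at the nodes: since [u] is [C^1], the difference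
    quotients of [u] are within [eta] of the values of [grad u] on the cell, and the
    resulting error [h eta sum_q w(q) <= C eta mu(box)] vanishes with [h]. Finally
    let [e] tend to [0]. *)

Require Import Defs.
From HB Require Import structures.
From mathcomp Require Import all_boot all_order all_algebra.
From mathcomp Require Import all_classical all_reals all_analysis.
From mathcomp Require Import measurable_realfun ring lra zify.

Set Implicit Arguments.
Unset Strict Implicit.
Unset Printing Implicit Defensive.

Import Order.TTheory GRing.Theory Num.Theory.
Import numFieldNormedType.Exports.
Local Open Scope classical_set_scope.
Local Open Scope ring_scope.

(** * The discrete inequality on a dyadic grid *)

Section grid.
Context {R : realFieldType} {n : nat}.
Implicit Types (p x : 'I_n -> nat) (g a : ('I_n -> nat) -> R).

(** By definition the transform is minus the gradient of the potential, so the claim is a trace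
    inequality for one C^1 function [u] that tends to 0 at infinity. In the continuum it would call
    for the coarea formula and for perimeters of level sets, tested against a possibly singular
    [mu]. On a grid these become finite sums: level sets are arbitrary finite sets, and the
    isoperimetric inequality is the l^1 Poincare inequality of an indicator. The delicate point is
    the way back. The maximal function is only ever bounded below, by constants on cells, so the
    discrete gradient has to lie below |grad u| at every point of a cell, not merely on average. The
    error made in arranging this is summed with weights over about [h^-n] cells. It stays under
    control because generation [j] contributes at most [2^j] times the total mass: the geometric sum
    is dominated by the coarsest scale and has size 1/h only. *)

Definition upd p (i : 'I_n) (t : nat) : 'I_n -> nat :=
  fun j => if j == i then t else p j.

Definition succ_at (i : 'I_n) p : 'I_n -> nat := upd p i (p i).+1.

Definition grad1 a x : R := \sum_(i < n) `|a (succ_at i x) - a x|.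

(** Grid points are functions into [nat], so that [succ_at] may leave a cube; the finite functions
    only index sums over a cube. *)
Definition pt {m} (q : {ffun 'I_n -> 'I_m}) : 'I_n -> nat := fun i => q i.

Definition fupd {m} (q : {ffun 'I_n -> 'I_m}) i t : {ffun 'I_n -> 'I_m} :=
  [ffun j => if j == i then t else q j].

Lemma pt_fupd m (q : {ffun 'I_n -> 'I_m}) i t : pt (fupd q i t) = upd (pt q) i t.
Proof. by apply/funext => j; rewrite /pt /upd /fupd ffunE; case: ifP. Qed.

Lemma sum_fupd m (F : {ffun 'I_n -> 'I_m} -> R) i :
  \sum_q \sum_(t < m) F (fupd q i t) = m%:R * \sum_q F q.
Proof.
transitivity (\sum_(p : {ffun 'I_n -> 'I_m} * 'I_m) F (fupd p.1 i p.2)).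
  by rewrite pair_big.
(* [swap] exchanges coordinate [i] of [q] with the free value [t]. After this involution [t]
   disappears from the summand and contributes the factor [m]. *)
pose swap (p : {ffun 'I_n -> 'I_m} * 'I_m) := (fupd p.1 i p.2, p.1 i).
have swapK : involutive swap.
  move=> [q t]; rewrite /swap/=; congr pair.
    by apply/ffunP => j; rewrite !ffunE /=; case: eqP => [->|].
  by rewrite ffunE eqxx.
rewrite (reindex_inj (inv_inj swapK))/=.
transitivity (\sum_(p : {ffun 'I_n -> 'I_m} * 'I_m) F p.1).
  apply: eq_bigr => -[q t] _ /=; congr F.
  by apply/ffunP => j; rewrite !ffunE /=; case: eqP => [->|].
rewrite -(pair_big xpredT xpredT (fun q (t : 'I_m) => F q))/= mulr_sumr.
by apply: eq_bigr => q _; rewrite sumr_const card_ord mulr_natl.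
Qed.

Definition avg m (i : 'I_n) g : ('I_n -> nat) -> R :=
  fun x => m%:R^-1 * \sum_(t < m) g (upd x i t).

Definition avgs m (s : seq 'I_n) g := foldr (avg m) g s.

Lemma avgs_const m s g x y : (forall i, i \notin s -> x i = y i) ->
  avgs m s g x = avgs m s g y.
Proof.
elim: s x y => [|i s ih] x y xy /=; first by congr g; apply/funext => j; exact: xy.
rewrite /avg; congr (_ * _); apply: eq_bigr => t _; apply: ih => j js.
by rewrite /upd; case: ifPn => // ji; apply: xy; rewrite in_cons negb_or ji.
Qed.

Lemma avg_contract m i g : (0 < m)%N ->
  \sum_(q : {ffun 'I_n -> 'I_m}) `|avg m i g (pt q)| <=
  \sum_(q : {ffun 'I_n -> 'I_m}) `|g (pt q)|.
Proof.
move=> m0; have mR : 0 < m%:R :> R by rewrite ltr0n.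
apply: (@le_trans _ _ (m%:R^-1 * \sum_(q : {ffun 'I_n -> 'I_m})
    \sum_(t < m) `|g (pt (fupd q i t))|)).
  rewrite mulr_sumr; apply: ler_sum => q _; rewrite /avg normrM ger0_norm ?invr_ge0 ?(ltW mR)//.
  rewrite ler_pM2l ?invr_gt0//; apply: le_trans (ler_norm_sum _ _ _) _.
  by apply: ler_sum => t _; rewrite pt_fupd.
by rewrite (sum_fupd (fun q => `|g (pt q)|)) mulKf// gt_eqF.
Qed.

(** With [A] for averages, [g - A_i A_s g = (g - A_i g) + A_i (g - A_s g)], and averaging contracts
    the l^1 norm: directions can be averaged out one at a time. *)
Lemma dist_avgs m s g : (0 < m)%N ->
  \sum_(q : {ffun 'I_n -> 'I_m}) `|g (pt q) - avgs m s g (pt q)| <=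
  \sum_(i <- s) \sum_(q : {ffun 'I_n -> 'I_m}) `|g (pt q) - avg m i g (pt q)|.
Proof.
move=> m0; elim: s => [|i s ih] /=.
  by rewrite big_nil big1// => q _; rewrite subrr normr0.
rewrite big_cons; apply: le_trans (lerD (lexx _) ih).
apply: le_trans (lerD (lexx _) (@avg_contract m i (fun x => g x - avgs m s g x) m0)).
rewrite -big_split; apply: ler_sum => q _ /=.
rewrite (_ : g _ - _ = (g (pt q) - avg m i g (pt q)) +
    avg m i (fun x => g x - avgs m s g x) (pt q)) ?ler_normD//.
by rewrite /avg sumrB mulrBr addrA subrK.
Qed.

(** The sum includes the jump to [phi m]: it matches [grad1], whose forward differences also leave
    the cube through its far faces. *)
Lemma telescope_bound (phi : nat -> R) m s t : (s < m)%N -> (t < m)%N ->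
  `|phi s - phi t| <= \sum_(r < m) `|phi r.+1 - phi r|.
Proof.
wlog st : s t / (s <= t)%N => [H sm tm|sm tm].
  have [/H|/ltnW/H] := leqP s t; first exact.
  by rewrite distrC; apply.
rewrite distrC -(telescope_sumr phi st).
apply: le_trans (ler_norm_sum _ _ _) _.
rewrite -(big_mkord xpredT (fun r => `|phi r.+1 - phi r|)).
rewrite [leRHS](big_cat_nat (n := s))//= ?(ltnW sm)//; apply: ler_wpDl; first exact: sumr_ge0.
by rewrite [leRHS](big_cat_nat (n := t))//= ?(ltnW tm)//; apply: ler_wpDr; first exact: sumr_ge0.
Qed.

(** On a line in direction [i], the distance to the mean is at most the variation [V] of the line.
    This bound is repeated at the [m] points of the line, whence the factor [m]. *)
Lemma dist_avg m i g : (0 < m)%N ->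
  \sum_(q : {ffun 'I_n -> 'I_m}) `|g (pt q) - avg m i g (pt q)| <=
  m%:R * \sum_(q : {ffun 'I_n -> 'I_m}) `|g (succ_at i (pt q)) - g (pt q)|.
Proof.
move=> m0; have mR : 0 < m%:R :> R by rewrite ltr0n.
rewrite -(sum_fupd (fun q => `|g (succ_at i (pt q)) - g (pt q)|) i).
apply: ler_sum => q _.
have -> : g (pt q) - avg m i g (pt q) =
    m%:R^-1 * \sum_(t < m) (g (pt q) - g (upd (pt q) i t)).
  rewrite sumrB sumr_const card_ord mulrBr -(mulr_natl (g _)) mulKf// gt_eqF//.
rewrite normrM ger0_norm ?invr_ge0 ?(ltW mR)// mulrC ler_pdivrMr//.
apply: le_trans (ler_norm_sum _ _ _) _.
set V := (X in _ <= X * _).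
have -> : V * m%:R = \sum_(t < m) V by rewrite sumr_const card_ord mulr_natr.
apply: ler_sum => t _; rewrite /V.
have e : upd (pt q) i (pt q i) = pt q by apply/funext => j; rewrite /upd; case: eqP => // ->.
have := @telescope_bound (fun r => g (upd (pt q) i r)) m (pt q i) t (ltn_ord _) (ltn_ord _).
rewrite e => /le_trans; apply; apply: ler_sum => r _.
rewrite pt_fupd le_eqVlt; apply/orP; left; apply/eqP; congr (`|g _ - _|).
apply/funext => j; rewrite /succ_at /upd eqxx; case: ifP => //.
Qed.

Lemma poincare m g : (0 < m)%N -> exists c : R,
  \sum_(q : {ffun 'I_n -> 'I_m}) `|g (pt q) - c| <=
  m%:R * \sum_(q : {ffun 'I_n -> 'I_m}) grad1 g (pt q).
Proof.
(* Averaging in every direction gives the mean over the cube. It is the same at all points, and is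
   read off at the origin. *)
move=> m0; exists (avgs m (enum 'I_n) g (fun=> 0%N)).
under eq_bigr => q _ do rewrite (@avgs_const m (enum 'I_n) g (fun=> 0%N) (pt q)
  (fun j jn => False_ind _ (elimN idP jn (mem_enum _ j)))).
apply: le_trans (dist_avgs _ _ m0) _.
rewrite big_enum /grad1 [in leRHS]exchange_big mulr_sumr; apply: ler_sum => i _.
exact: dist_avg.
Qed.

Definition ind (E : pred ('I_n -> nat)) : ('I_n -> nat) -> R := fun x => (E x)%:R.

(** For an indicator, the left side of [poincare] is [S |1 - c| + (m^n - S) |c|]. Since
    [S <= m^n - S], it is at least [S (|1 - c| + |c|) >= S], whatever [c] is. *)
Lemma isoperimetric m (E : pred ('I_n -> nat)) : (0 < m)%N ->
  2 * \sum_(q : {ffun 'I_n -> 'I_m}) ind E (pt q) <= (m ^ n)%:R ->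
  \sum_(q : {ffun 'I_n -> 'I_m}) ind E (pt q) <=
  m%:R * \sum_(q : {ffun 'I_n -> 'I_m}) grad1 (ind E) (pt q).
Proof.
move=> m0; have [c cP] := poincare (ind E) m0; set S := \sum_q ind E (pt q) => S2.
apply: le_trans cP.
have -> : \sum_(q : {ffun 'I_n -> 'I_m}) `|ind E (pt q) - c| =
    S * `|1 - c| + ((m ^ n)%:R - S) * `|c|.
  have -> : (m ^ n)%:R = \sum_(q : {ffun 'I_n -> 'I_m}) 1 :> R.
    by rewrite sumr_const card_ffun !card_ord.
  rewrite -sumrB !mulr_suml -big_split; apply: eq_bigr => q _ /=.
  rewrite /ind; case: (E _); rewrite ?subrr ?subr0 ?mul0r ?mul1r ?addr0// sub0r normrN add0r//.
have S0 : 0 <= S by apply: sumr_ge0 => q _; rewrite /ind ler0n.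
have h : 1 <= `|1 - c| + `|c|.
  by apply: le_trans (ler_normD _ _); rewrite subrK normr1.
have := normr_ge0 c; have := normr_ge0 (1 - c); nra.
Qed.

End grid.

(** * Dyadic cubes and the boxing argument on the grid *)

Section dyadic.
Context {R : realFieldType} {n : nat}.
Implicit Types (k p x : 'I_n -> nat) (a : ('I_n -> nat) -> R).

(** [k] numbers a cube of side [m] and [p] is an offset in it. The same formula numbers the children
    of a cube. *)
Definition cube_pt (m : nat) k p : 'I_n -> nat := fun i => (m * k i + p i)%N.

Lemma cube_pt_succ_at m k p i : cube_pt m k (succ_at i p) = succ_at i (cube_pt m k p).
Proof.
by apply/funext => j; rewrite /cube_pt /succ_at /upd; case: (j =P i) => [->|]; rewrite ?addnS.
Qed.

Lemma cube_pt0 m p : cube_pt m (fun=> 0%N) p = p.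
Proof. by apply/funext => i; rewrite /cube_pt muln0. Qed.

Lemma child_subproof c m (b : 'I_c) (q : 'I_m) : (m * b + q < c * m)%N.
Proof. by have := ltn_ord b; have := ltn_ord q; nia. Qed.

Definition of_child c m (p : {ffun 'I_n -> 'I_c} * {ffun 'I_n -> 'I_m}) :
    {ffun 'I_n -> 'I_(c * m)} :=
  [ffun i => Ordinal (child_subproof (p.1 i) (p.2 i))].

Lemma of_child_bij c m : (0 < m)%N -> bijective (@of_child c m).
Proof.
move=> m0.
have h1 (q : 'I_(c * m)) : (q %/ m < c)%N by rewrite ltn_divLR.
have h2 (q : 'I_(c * m)) : (q %% m < m)%N by rewrite ltn_mod.
exists (fun q : {ffun 'I_n -> 'I_(c * m)} =>
  ([ffun i => Ordinal (h1 (q i))], [ffun i => Ordinal (h2 (q i))])).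
  move=> [b q]; congr pair; apply/ffunP => i; rewrite !ffunE; apply: val_inj => /=.
    by rewrite mulnC divnMDl// divn_small ?addn0.
  by rewrite mulnC modnMDl modn_small.
move=> q; apply/ffunP => i; rewrite !ffunE; apply: val_inj => /=.
by rewrite mulnC -divn_eq.
Qed.

Lemma sum_children c m k (F : ('I_n -> nat) -> R) : (0 < m)%N ->
  \sum_(q : {ffun 'I_n -> 'I_(c * m)}) F (cube_pt (c * m) k (pt q)) =
  \sum_(b : {ffun 'I_n -> 'I_c}) \sum_(q : {ffun 'I_n -> 'I_m})
     F (cube_pt m (cube_pt c k (pt b)) (pt q)).
Proof.
move=> m0; rewrite (reindex (@of_child c m)) /=; last exact/onW_bij/of_child_bij.
rewrite pair_big; apply: eq_bigr => -[b q] _ /=; congr F; apply/funext => i.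
by rewrite /cube_pt /pt ffunE /= mulnDr mulnA (mulnC m c) addnA.
Qed.

Lemma sum_children_expn j k (F : ('I_n -> nat) -> R) :
  \sum_(q : {ffun 'I_n -> 'I_(2 ^ j.+1)}) F (cube_pt (2 ^ j.+1) k (pt q)) =
  \sum_(b : {ffun 'I_n -> 'I_2}) \sum_(q : {ffun 'I_n -> 'I_(2 ^ j)})
     F (cube_pt (2 ^ j) (cube_pt 2 k (pt b)) (pt q)).
Proof. by rewrite expnS sum_children ?expn_gt0. Qed.

Lemma sum_grid j d (F : ('I_n -> nat) -> R) : (j <= d)%N ->
  \sum_(q : {ffun 'I_n -> 'I_(2 ^ d)}) F (pt q) =
  \sum_(b : {ffun 'I_n -> 'I_(2 ^ (d - j))}) \sum_(q : {ffun 'I_n -> 'I_(2 ^ j)})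
     F (cube_pt (2 ^ j) (pt b) (pt q)).
Proof.
move=> jd; have -> : (2 ^ d = 2 ^ (d - j) * 2 ^ j)%N by rewrite -expnD subnK.
transitivity (\sum_(q : {ffun 'I_n -> 'I_(2 ^ (d - j) * 2 ^ j)})
    F (cube_pt (2 ^ (d - j) * 2 ^ j) (fun=> 0%N) (pt q))).
  by apply: eq_bigr => q _; rewrite cube_pt0.
rewrite sum_children ?expn_gt0//.
by apply: eq_bigr => b _; apply: eq_bigr => q _; rewrite cube_pt0.
Qed.

Lemma ind01 (E : pred ('I_n -> nat)) x : 0 <= (ind E x : R) <= 1.
Proof. by rewrite /ind; case: (E x); rewrite ?ler01 ?lexx. Qed.

Lemma grad1_ge0 a x : 0 <= grad1 a x.
Proof. exact: sumr_ge0. Qed.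

Section sobolev.
Variables (mu w : ('I_n -> nat) -> R) (D : nat).
Hypothesis n0 : (0 < n)%N.
Hypothesis mu0 : forall x, 0 <= mu x.
Hypothesis w0 : forall x, 0 <= w x.
Hypothesis muw : forall j k (q : {ffun 'I_n -> 'I_(2 ^ j)}), (j <= D)%N ->
  \sum_(p : {ffun 'I_n -> 'I_(2 ^ j)}) mu (cube_pt (2 ^ j) k (pt p)) <=
  w (cube_pt (2 ^ j) k (pt q)) * (2 ^ j)%:R ^+ n.-1.

(** Bound the mass of [E] by the mass [M] of the cube, then chain [m^n < 2^n * 2 S] (density),
    [S <= m G] (isoperimetry) and [M G <= m^(n-1) W] ([muw] at each point, weighted by the
    gradient). The constant is [2^n], the volume ratio of parent and child, times 2 for density one
    half. *)
Lemma dense_cube_sobolev (E : pred ('I_n -> nat)) j k : (j < D)%N ->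
  let Q := {ffun 'I_n -> 'I_(2 ^ j.+1)} in
  2 * \sum_(q : Q) ind E (cube_pt (2 ^ j.+1) k (pt q)) <= ((2 ^ j.+1) ^ n)%:R :> R ->
  ((2 ^ j) ^ n)%:R < 2 * \sum_(q : Q) ind E (cube_pt (2 ^ j.+1) k (pt q)) :> R ->
  \sum_(q : Q) mu (cube_pt (2 ^ j.+1) k (pt q)) * ind E (cube_pt (2 ^ j.+1) k (pt q)) <=
  2 ^+ n.+1 * \sum_(q : Q) w (cube_pt (2 ^ j.+1) k (pt q)) *
                           grad1 (ind E) (cube_pt (2 ^ j.+1) k (pt q)).
Proof.
move=> jD Q; set m := (2 ^ j.+1)%N.
have m0 : (0 < m)%N by rewrite expn_gt0.
have mR : 0 < m%:R :> R by rewrite ltr0n.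
set S := \sum_q ind E _ => Sle Sgt.
pose G : R := \sum_(q : Q) grad1 (ind E) (cube_pt m k (pt q)).
have SG : S <= m%:R * G.
  have := @isoperimetric R n m (fun x => E (cube_pt m k x)) m0 Sle.
  move/le_trans; apply; rewrite ler_pM2l//; apply: ler_sum => q _.
  by apply: ler_sum => i _; rewrite /ind cube_pt_succ_at.
pose M : R := \sum_(q : Q) mu (cube_pt m k (pt q)).
have M0 : 0 <= M by apply: sumr_ge0.
apply: (@le_trans _ _ M).
  apply: ler_sum => q _; have /andP[? ?] := @ind01 E (cube_pt m k (pt q)).
  by rewrite ler_piMr.
set W := \sum_q _ * _.
have MG : M * G <= W * m%:R ^+ n.-1.
  rewrite mulr_sumr mulr_suml; apply: ler_sum => q _.
  by rewrite -mulrA (mulrC (grad1 _ _)) mulrA ler_wpM2r ?grad1_ge0//; exact: muw.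
have mn : m%:R ^+ n = m%:R * m%:R ^+ n.-1 :> R by rewrite -exprS prednK.
have mn2 : m%:R ^+ n = 2 ^+ n * ((2 ^ j) ^ n)%:R :> R.
  by rewrite -natrX /m expnS expnMn natrM natrX.
have mn0 : 0 < m%:R ^+ n :> R by rewrite exprn_gt0.
suff : M * m%:R ^+ n <= 2 ^+ n.+1 * W * m%:R ^+ n by rewrite ler_pM2r.
rewrite {2}mn.
have -> : 2 ^+ n.+1 * W * (m%:R * m%:R ^+ n.-1) =
  2 ^+ n * (2 * (m%:R * (W * m%:R ^+ n.-1))) by rewrite exprS; ring.
rewrite mn2 mulrCA ler_pM2l ?exprn_gt0//.
apply: (@le_trans _ _ (2 * (m%:R * (M * G)))); last by rewrite !ler_pM2l.
apply: (@le_trans _ _ (M * (2 * S))); first by rewrite ler_wpM2l// ltW.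
have := ler_wpM2l M0 SG; lra.
Qed.

(** The stopping time is an induction on the generation: either all children have density at most
    1/2 and their bounds add up, or one is denser and the cube is kept whole. Keeping the parent of
    the dense cube leaves a density between [2^-(n+1)] and 1/2, as [dense_cube_sobolev] requires. *)
Lemma set_sobolev (E : pred ('I_n -> nat)) j k : (j <= D)%N ->
  2 * \sum_(q : {ffun 'I_n -> 'I_(2 ^ j)}) ind E (cube_pt (2 ^ j) k (pt q)) <=
    ((2 ^ j) ^ n)%:R :> R ->
  \sum_(q : {ffun 'I_n -> 'I_(2 ^ j)})
     mu (cube_pt (2 ^ j) k (pt q)) * ind E (cube_pt (2 ^ j) k (pt q)) <=
  2 ^+ n.+1 * \sum_(q : {ffun 'I_n -> 'I_(2 ^ j)})
     w (cube_pt (2 ^ j) k (pt q)) * grad1 (ind E) (cube_pt (2 ^ j) k (pt q)).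
Proof.
elim: j k => [|j ih] k jD Eh.
  (* A single cell of density at most 1/2 does not meet [E]. *)
  rewrite big1 => [|q _].
    rewrite mulr_ge0 ?exprn_ge0//; apply: sumr_ge0 => q _.
    by rewrite mulr_ge0// grad1_ge0.
  apply/eqP; rewrite mulf_eq0; apply/orP; right; rewrite /ind pnatr_eq0 eqb0.
  apply/negP => Eq; move: Eh; rewrite expn0 exp1n (bigD1 q)//= {1}/ind Eq.
  apply/negP; rewrite -ltNge; set s := \sum_(i | _) _.
  have : 0 <= s by apply: sumr_ge0 => i _; have /andP[] := @ind01 E (cube_pt 1 k (pt i)).
  by rewrite mulr1n; lra.
have [/forallP Eb|] := boolP [forall b : {ffun 'I_n -> 'I_2},
    2 * \sum_(q : {ffun 'I_n -> 'I_(2 ^ j)})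
       ind E (cube_pt (2 ^ j) (cube_pt 2 k (pt b)) (pt q)) <= ((2 ^ j) ^ n)%:R :> R].
  rewrite (sum_children_expn _ k (fun x => mu x * ind E x)).
  rewrite (sum_children_expn _ k (fun x => w x * grad1 (ind E) x)).
  by rewrite mulr_sumr; apply: ler_sum => b _; apply: ih (Eb b); exact: ltnW.
rewrite negb_forall => /existsP[b]; rewrite -ltNge => Eb.
apply: dense_cube_sobolev => //.
apply: lt_le_trans Eb _; rewrite ler_pM2l//.
rewrite (sum_children_expn _ k (fun x => ind E x)).
rewrite (bigD1 b)//= lerDl; apply: sumr_ge0 => b' _; apply: sumr_ge0 => q _.
by have /andP[] := @ind01 E (cube_pt (2 ^ j) (cube_pt 2 k (pt b')) (pt q)).
Qed.

(** [E] sits in one of the [2^n] children of the top cube, so its density there is at most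
    [2^-n <= 1/2] and the recursion can start. *)
Lemma sobolev_supp (E : pred ('I_n -> nat)) : (0 < D)%N ->
  (forall x i, (2 ^ D.-1 <= x i)%N -> ~~ E x) ->
  \sum_(q : {ffun 'I_n -> 'I_(2 ^ D)}) mu (pt q) * ind E (pt q) <=
  2 ^+ n.+1 * \sum_(q : {ffun 'I_n -> 'I_(2 ^ D)}) w (pt q) * grad1 (ind E) (pt q).
Proof.
move=> D0 ED.
have e (F : ('I_n -> nat) -> R) : \sum_(q : {ffun 'I_n -> 'I_(2 ^ D)}) F (pt q) =
    \sum_(q : {ffun 'I_n -> 'I_(2 ^ D)}) F (cube_pt (2 ^ D) (fun=> 0%N) (pt q)).
  by apply: eq_bigr => q _; rewrite cube_pt0.
rewrite (e (fun x => mu x * ind E x)) (e (fun x => w x * grad1 (ind E) x)).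
apply: set_sobolev => // {e}.
case: D D0 ED => // d _ /= ED.
rewrite (@sum_children_expn d (fun=> 0%N) (fun x => ind E x)).
rewrite (bigD1 [ffun=> ord0])//= [X in _ + X]big1 ?addr0 => [|b b0].
  apply: (@le_trans _ _ (2 * ((2 ^ d) ^ n)%:R)).
    rewrite ler_pM2l//.
    have -> : ((2 ^ d) ^ n)%:R = \sum_(q : {ffun 'I_n -> 'I_(2 ^ d)}) 1 :> R.
      by rewrite sumr_const card_ffun !card_ord.
    by apply: ler_sum => q _; exact: (proj2 (andP (@ind01 E _))).
  rewrite -natrM ler_nat expnS expnMn leq_pmul2r ?expn_gt0 ?expn_gt0//.
  by rewrite -[X in (X <= _)%N]expn1 leq_exp2l.
have [i bi] : exists i, b i != ord0.
  apply/existsP; apply: contraNT b0; rewrite negb_exists => /forallP h.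
  by apply/eqP/ffunP => i; rewrite ffunE; apply/eqP; have := h i; rewrite negbK.
apply: big1 => q _; rewrite /ind (negbTE (ED _ i _))// /cube_pt /pt.
have : (0 < b i)%N by rewrite lt0n; apply: contra bi => /eqP h; apply/eqP/val_inj.
by nia.
Qed.

(** Equality case of the triangle inequality: [p] and [q] vanish off [e] and [f], so the jump of the
    layer and that of the remainder never have opposite signs. *)
Let norm_peel (t p q : R) (e f : bool) : 0 <= t -> 0 <= p -> 0 <= q ->
  (~~ e -> p = 0) -> (~~ f -> q = 0) ->
  `|t * f%:R + q - (t * e%:R + p)| = t * `|f%:R - e%:R| + `|q - p|.
Proof.
move=> t0 p0 q0; case: e => [_|/(_ isT) ->]; case: f => [_|/(_ isT) ->];
  rewrite ?mulr1n ?mulr0n ?mulr1 ?mulr0 ?add0r ?addr0 ?subrr ?subr0 ?sub0r ?normrN ?normr1 ?normr0 ?mulr1 ?mulr0 ?add0r ?addr0//.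
- by congr (`|_|); ring.
- by rewrite !ger0_norm// addr_ge0.
- by rewrite !ger0_norm// addr_ge0.
Qed.

(* Layer-cake: peel off the smallest positive value of [a] times the indicator
   of its support; the discrete gradient is additive in this decomposition. *)
Lemma sobolev a : (0 < D)%N -> (forall x, 0 <= a x) ->
  (forall x i, (2 ^ D.-1 <= x i)%N -> a x = 0) ->
  \sum_(q : {ffun 'I_n -> 'I_(2 ^ D)}) mu (pt q) * a (pt q) <=
  2 ^+ n.+1 * \sum_(q : {ffun 'I_n -> 'I_(2 ^ D)}) w (pt q) * grad1 a (pt q).
Proof.
move=> D0.
(* Induction on the size of the support: each peeling removes at least the minimiser [q1]. *)
have [N] := ubnP #|[pred q : {ffun 'I_n -> 'I_(2 ^ D)} | a (pt q) != 0]|.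
elim: N a => // N ih a /ltnSE aN a0 aD.
have [/existsP[q0 aq0]|/existsPn az] := boolP
    [exists q : {ffun 'I_n -> 'I_(2 ^ D)}, a (pt q) != 0]; last first.
  rewrite big1 => [|q _]; last by have /negPn/eqP -> := az q; rewrite mulr0.
  rewrite mulr_ge0 ?exprn_ge0//; apply: sumr_ge0 => q _.
  by rewrite mulr_ge0// grad1_ge0.
case: (@arg_minP _ _ _ q0 (fun q : {ffun 'I_n -> 'I_(2 ^ D)} => a (pt q) != 0)
  (fun q => a (pt q)) aq0) => q1 aq1 tmin.
set t := a (pt q1) in tmin.
(* The support lies inside the grid, so a minimum over the grid is one over the whole support. Thus
   the remainder [b] is nonnegative everywhere, also at neighbours outside the cube. *)
have gridP x : a x != 0 -> exists q : {ffun 'I_n -> 'I_(2 ^ D)}, x = pt q.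
  move=> ax; have xD i : (x i < 2 ^ D)%N.
    rewrite ltnNge; apply: contra ax => xi; apply/eqP/(aD x i)/(leq_trans _ xi).
    by rewrite leq_exp2l// leq_pred.
  by exists [ffun i => Ordinal (xD i)]; apply/funext => i; rewrite /pt ffunE.
pose E : pred ('I_n -> nat) := fun x => a x != 0.
pose b x : R := a x - t * ind E x.
have t0 : 0 < t by rewrite lt_def aq1 a0.
have bE x : ~~ E x -> b x = 0.
  by move=> Ex; rewrite /b /ind (negbTE Ex); move: Ex => /negPn/eqP ->; rewrite mulr0 subr0.
have b0 x : 0 <= b x.
  have [Ex|/bE-> //] := boolP (E x).
  have [q xq] := gridP x Ex; rewrite /b /ind Ex mulr1 subr_ge0 xq; apply: tmin.
  by rewrite -xq.
have bD x i : (2 ^ D.-1 <= x i)%N -> b x = 0.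
  by move=> /aD ax; apply: bE; rewrite /E ax eqxx.
have bN : (#|[pred q : {ffun 'I_n -> 'I_(2 ^ D)} | b (pt q) != 0%R]| < N)%N.
  apply: leq_trans aN; apply: proper_card; apply/properP; split.
    apply/fintype.subsetP => q; rewrite !inE; apply: contra => aq.
    by apply/eqP/bE; rewrite /E negbK.
  exists q1; rewrite !inE//; rewrite /b /ind /E aq1 mulr1 subrr eqxx//.
have ED x i : (2 ^ D.-1 <= x i)%N -> ~~ E x.
  by move=> /aD ax; rewrite /E ax eqxx.
have ab x : a x = t * ind E x + b x by rewrite /b addrC subrK.
have gradD x : grad1 a x = t * grad1 (ind E) x + grad1 b x.
  rewrite /grad1 mulr_sumr -big_split; apply: eq_bigr => i _ /=.
  set y := succ_at i x.
  by rewrite {1}(ab x) {1}(ab y) /ind; apply: norm_peel => //; [exact: ltW|exact: bE|exact: bE].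
have := sobolev_supp D0 ED; have := ih b bN b0 bD.
set Sb := \sum_q _ * b _; set Sg := \sum_q _ * grad1 b _.
set SE := \sum_q _ * ind E _; set SgE := \sum_q _ * grad1 (ind E) _ => hb hE.
have -> : \sum_(q : {ffun 'I_n -> 'I_(2 ^ D)}) mu (pt q) * a (pt q) = t * SE + Sb.
  rewrite mulr_sumr -big_split; apply: eq_bigr => q _ /=.
  by rewrite {1}ab mulrDr mulrCA.
have -> : \sum_(q : {ffun 'I_n -> 'I_(2 ^ D)}) w (pt q) * grad1 a (pt q) = t * SgE + Sg.
  rewrite mulr_sumr -big_split; apply: eq_bigr => q _ /=.
  by rewrite gradD mulrDr mulrCA.
rewrite mulrDr lerD// mulrCA ler_pM2l//.
Qed.

End sobolev.
End dyadic.

(** * Translation invariance of Lebesgue measure *)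

Section translation.
Context {R : realType}.
Local Open Scope ereal_scope.

Lemma measurable_addl (a : R) :
  measurable_fun [set: measurableTypeR R] ((fun x => (a + x)%R) : measurableTypeR R -> measurableTypeR R).
Proof. exact: measurable_funD. Qed.

Lemma lebesgue_measure_translation (a : R) (A : set (measurableTypeR R)) : measurable A ->
  pushforward (@lebesgue_measure R) (fun x : measurableTypeR R => (a + x)%R : measurableTypeR R) A
  = lebesgue_measure A.
Proof.
move=> mA; pose mf := isMeasurableFun.Build _ _ _ _ _ (measurable_addl a).
pose f : {mfun _ >-> _} := HB.pack (fun x : measurableTypeR R => (a + x)%R : measurableTypeR R) mf.
apply/esym; apply: (@lebesgue_measure_unique R (pushforward lebesgue_measure f)) => // X [[x y] _ <-].
rewrite /pushforward /=.
rewrite [X in _ = lebesgue_measure X](_ : _ = `](x - a)%R, (y - a)%R]%classic); last first.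
  by apply/seteqP; split => z /=; rewrite !in_itv/= ltrBlDl lerBrDl.
rewrite !lebesgue_measure_itv/= !lte_fin ltrD2r; case: ifPn => // _.
by rewrite -!EFinB; congr (_%:E); ring.
Qed.

Lemma ge0_integral_translation (a : R) (f : measurableTypeR R -> \bar R) :
  measurable_fun setT f -> (forall x, 0 <= f x) ->
  \int[lebesgue_measure]_x f (a + x)%R = \int[lebesgue_measure]_x f x.
Proof.
move=> mf f0.
have := @ge0_integral_pushforward _ _ _ _ R _ (measurable_addl a) (@lebesgue_measure R) setT f
  measurableT mf (fun y _ => f0 y).
rewrite preimage_setT => <-; apply: eq_measure_integral; first exact: measurable_addl.
move=> ? A mA _; exact: lebesgue_measure_translation.
Qed.

Lemma measurable_addlRV n (a : 'rV[R]_n) :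
  measurable_fun [set: borelRV R n] ((fun x => a + x)%R : borelRV R n -> borelRV R n).
Proof.
apply: measurable_fun_borelRV => i; under eq_fun do rewrite mxE.
by apply: (measurableT_comp (measurable_addl (a ord0 i)) (measurable_coord i)).
Qed.

Lemma ge0_integral_lebesgueRVS n (f : borelRV R n.+1 -> \bar R) :
  measurable_fun setT f -> (forall x, 0 <= f x) ->
  \int[lebesgueRV R n.+1]_x f x =
  \int[lebesgue_measure]_t \int[lebesgueRV R n]_v f (consRV (t, v)).
Proof.
move=> mf f0; rewrite /= /lebesgueRV_step.
rewrite (ge0_integral_pushforward (@measurable_consRV R n))// preimage_setT.
rewrite fubini_tonelli1//.
- exact: measurableT_comp mf (@measurable_consRV R n).
- by move=> x; exact: f0.
Qed.

Lemma consRVD n (a : 'rV[R]_n.+1) (t : R) (v : 'rV[R]_n) :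
  (a + consRV (t, v) =
   consRV ((unconsRV a).1 + t, ((unconsRV a).2 : 'rV[R]_n) + v))%R.
Proof.
apply/rowP => i; rewrite mxE.
case: (@split_ordP 1 n i) => j ->.
  rewrite (consRVl (t, v)) (consRVl (_, _)) /unconsRV/= (ord1 j).
  by congr (a _ _ + _)%R; exact: val_inj.
by rewrite (consRVr (t, v)) (consRVr (_, _)) /unconsRV/= !mxE.
Qed.

Lemma ge0_integral_translationRV n (a : 'rV[R]_n) (f : borelRV R n -> \bar R) :
  measurable_fun setT f -> (forall x, 0 <= f x) ->
  \int[lebesgueRV R n]_x f (a + x)%R = \int[lebesgueRV R n]_x f x.
Proof.
elim: n a f => [|n ih] a f mf f0.
  by apply: eq_integral => x _; congr f; apply/rowP => -[].
have mfa : measurable_fun setT (fun x : borelRV R n.+1 => f (a + x)%R).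
  exact: measurableT_comp mf (measurable_addlRV a).
rewrite !ge0_integral_lebesgueRVS//.
under eq_integral do under eq_integral do rewrite consRVD.
transitivity (\int[lebesgue_measure]_t
    \int[lebesgueRV R n]_v f (consRV ((unconsRV a).1 + t, v)%R)).
  apply: eq_integral => t _.
  apply: (ih (unconsRV a).2 (fun v => f (consRV ((unconsRV a).1 + t, v)%R))) => //.
  apply: (measurableT_comp mf); apply: (measurableT_comp (@measurable_consRV R n)).
  exact: measurable_pair1.
have mF : measurable_fun [set: measurableTypeR R]
    (fun t => \int[lebesgueRV R n]_v f (consRV (t, v))).
  apply: (@measurable_fun_fubini_tonelli_F _ _ _ _ _ _ (fun p => f (consRV p))) => //.
  exact: measurableT_comp mf (@measurable_consRV R n).
apply: (ge0_integral_translation (unconsRV a).1 mF) => t.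
by apply: integral_ge0.
Qed.

(** Positive and negative parts are translated separately, so measurability of [f] suffices. *)
Lemma Rintegral_translationRV n (a : 'rV[R]_n) (f : borelRV R n -> R) :
  measurable_fun setT f ->
  (\int[lebesgueRV R n]_x f (a + x) = \int[lebesgueRV R n]_x f x)%R.
Proof.
move=> mf; have mE : measurable_fun setT (EFin \o f) by exact/measurable_EFinP.
rewrite /Rintegral; congr fine; rewrite integralE [RHS]integralE; congr (_ - _).
- apply: etrans (ge0_integral_translationRV a (measurable_funepos mE) (funepos_ge0 _)).
  by apply: eq_integral => x _; rewrite !funeposE.
- apply: etrans (ge0_integral_translationRV a (measurable_funeneg mE) (funeneg_ge0 _)).
  by apply: eq_integral => x _; rewrite !funenegE.
Qed.

End translation.

(** * Euclidean norm, balls and cubes *)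

Section euclidean.
Context {R : realType} {n : nat}.
Implicit Types x y z : 'rV[R]_n.

Lemma coord_le_norm x i : `|x ord0 i| <= `|x|.
Proof.
rewrite /Num.norm/= mx_normrE.
by apply: (le_bigmax _ (fun p : 'I_1 * 'I_n => `|x p.1 p.2|) (ord0, i)).
Qed.

Lemma rV_norm_lt x (r : R) : 0 < r -> (`|x| < r <-> forall i, `|x ord0 i| < r).
Proof.
move=> r0; split=> [xr i|xr]; first exact: le_lt_trans (coord_le_norm x i) xr.
rewrite /Num.norm/= mx_normrE; apply/bigmax_ltP; split=> // -[i j] _ /=.
by rewrite (ord1 i).
Qed.

Lemma rV_norm_le x (r : R) : 0 <= r -> (forall i, `|x ord0 i| <= r) -> `|x| <= r.
Proof.
move=> r0 xr; rewrite /Num.norm/= mx_normrE; apply/bigmax_leP; split=> // -[i j] _ /=.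
by rewrite (ord1 i).
Qed.

Lemma norm_scale_delta (h : R) (i : 'I_n) : `|h *: delta_mx ord0 i : 'rV[R]_n| = `|h|.
Proof.
apply/le_anti/andP; split.
  apply: rV_norm_le => // j; rewrite !mxE eqxx/=.
  by case: eqP; rewrite ?mulr1 ?mulr0 ?normr0.
by have := coord_le_norm (h *: delta_mx ord0 i) i; rewrite !mxE !eqxx mulr1.
Qed.

Lemma enorm_ge0 x : 0 <= enorm x. Proof. exact: sqrtr_ge0. Qed.

Lemma coord_le_enorm x i : `|x ord0 i| <= enorm x.
Proof.
rewrite /enorm -sqrtr_sqr ler_wsqrtr// (bigD1 i)//= lerDl.
by apply: sumr_ge0 => j _; exact: sqr_ge0.
Qed.

Lemma norm_le_enorm x : `|x| <= enorm x.
Proof. apply: rV_norm_le => [|i]; [exact: enorm_ge0 | exact: coord_le_enorm]. Qed.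

Lemma enorm_le x : enorm x <= n%:R * `|x|.
Proof.
have h0 : 0 <= n%:R * `|x| by rewrite mulr_ge0.
rewrite /enorm -(ger0_norm h0) -sqrtr_sqr ler_wsqrtr// exprMn.
apply: (@le_trans _ _ (\sum_(i < n) `|x| ^+ 2)).
  apply: ler_sum => i _; rewrite -[leLHS]ger0_norm ?sqr_ge0// normrX.
  by rewrite lerXn2r ?nnegrE// coord_le_norm.
rewrite sumr_const card_ord -(mulr_natl (_ ^+ _)); apply: ler_wpM2r; first exact: sqr_ge0.
rewrite -natrX ler_nat; by case: n => // m; rewrite expnS leq_pmulr// expn_gt0.
Qed.

Lemma enormN x : enorm (- x) = enorm x.
Proof. by rewrite /enorm; congr Num.sqrt; apply: eq_bigr => i _; rewrite mxE sqrrN. Qed.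

Lemma enorm0 : enorm (0 : 'rV[R]_n) = 0.
Proof. by rewrite /enorm big1 ?sqrtr0// => i _; rewrite mxE expr0n. Qed.

Lemma measurable_enorm : measurable_fun [set: borelRV R n] (enorm : borelRV R n -> measurableTypeR R).
Proof.
apply: (@measurableT_comp _ _ _ _ _ _ (Num.sqrt : R -> R) setT
  (fun x : borelRV R n => \sum_i (x : 'rV[R]_n) ord0 i ^+ 2)).
  exact: continuous_measurable_fun (@sqrt_continuous R).
by apply: measurable_sum => i; apply: measurable_funX; exact: measurable_coord.
Qed.

Lemma measurable_eball x r : measurable (eball x r : set (borelRV R n)).
Proof.
rewrite (_ : eball x r = (enorm \o (fun y => - x + y)) @^-1` `]-oo, r[%classic).
  rewrite -[X in measurable X]setTI.
  by apply: (measurableT_comp measurable_enorm (measurable_addlRV (- x))).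
have e y : enorm (x - y) = enorm (- x + y) by rewrite -enormN opprB addrC.
by apply/seteqP; split => y; rewrite /eball /= in_itv/= e.
Qed.

Lemma continuous_measurableRV (f : 'rV[R]_n -> R) : continuous f ->
  measurable_fun [set: borelRV R n] (f : borelRV R n -> measurableTypeR R).
Proof.
move=> cf; apply: (measurability _ (RGenOpens.measurableE R)).
move=> _ [_ [a [b ->]] <-]; rewrite setTI; apply: sub_sigma_algebra.
by move/continuousP : cf; apply; exact: interval_open.
Qed.

(** A ball of the sup norm, hence a cube of side [2 * r], whose volume is a product. *)
Definition box (r : R) : set (borelRV R n) := [set x : 'rV[R]_n | `|x| < r].

Lemma measurable_box r : measurable (box r).
Proof.
apply: sub_sigma_algebra; rewrite /box.
rewrite (_ : mkset _ = [set x : 'rV[R]_n | `|x| \in `]-oo, r[ ]); last first.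
  by apply/seteqP; split => x /=; rewrite in_itv.
move/continuousP : (@norm_continuous R 'rV[R]_n) => /(_ `]-oo, r[%classic).
by apply; exact: interval_open.
Qed.

Lemma lebesgue_cube x (r : R) : 0 < r ->
  lebesgueRV R n [set y : 'rV[R]_n | forall i, y ord0 i \in `](x ord0 i - r), (x ord0 i + r)[] =
  ((2 * r) ^+ n)%:E.
Proof.
move=> r0; have := @lebesgueRV_box R n
  (fun i => `](x ord0 i - r), (x ord0 i + r)[%classic) (fun i => measurable_itv _).
move=> ->.
under eq_bigr => i _.
  rewrite lebesgue_measure_itv/= lte_fin ltrBlDr -addrA ltrDl addr_gt0//.
  rewrite -EFinB (_ : _ - _ = 2 * r); last by ring.
  over.
by rewrite prodEFin prodr_const card_ord.
Qed.

Lemma lebesgue_box (r : R) : 0 < r -> lebesgueRV R n (box r) = ((2 * r) ^+ n)%:E.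
Proof.
move=> r0; rewrite -(lebesgue_cube 0 r0); congr (lebesgueRV R n _).
by apply/seteqP; split => x; rewrite /box /=; [move/(rV_norm_lt _ r0) => h i|move=> h;
  apply/(rV_norm_lt _ r0) => i]; have := h i; rewrite mxE sub0r add0r in_itv/= ltr_norml.
Qed.

(** An upper bound on the volume is what bounds the quotients in [maximal1] from below. *)
Lemma lebesgue_eball_le x (r : R) : 0 < r -> (lebesgueRV R n (eball x r) <= ((2 * r) ^+ n)%:E)%E.
Proof.
move=> r0; rewrite -(lebesgue_cube x r0); apply: le_measure; rewrite ?inE.
- exact: measurable_eball.
- rewrite (_ : mkset _ = \bigcap_(i in [set: 'I_n])
      ((fun v : borelRV R n => v ord0 i) @^-1` `](x ord0 i - r), (x ord0 i + r)[%classic)).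
    apply: fin_bigcap_measurable => // i _; rewrite -[X in measurable X]setTI.
    exact: measurable_coord.
  by apply/seteqP; split => [v Av i _|v Av i]; exact: Av.
move=> y /= xy i; rewrite in_itv/=; rewrite -ltr_distl distrC.
by apply: le_lt_trans xy; have := coord_le_enorm (x - y) i; rewrite !mxE.
Qed.

End euclidean.

(** * The kernel of order one *)

Section kernel.
Context {R : realType} {n : nat}.
Hypothesis hn : (2 <= n)%N.
Implicit Types x y z : 'rV[R]_n.
Local Notation leb := (lebesgueRV R n).
Local Notation box := (@box R n).

Definition rker z : R := (enorm z `^ (n%:R - 1))^-1.

Let predE : n%:R - 1 = n.-1%:R :> R.
Proof. by rewrite -subn1 natrB// (leq_trans _ hn). Qed.

Lemma rker_ge0 z : 0 <= rker z.
Proof. by rewrite invr_ge0 powR_ge0. Qed.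

(** At the singularity the kernel takes the default value [0^-1 = 0]; the exponent [n - 1] is
    nonzero because [n >= 2]. *)
Lemma rker0 : rker 0 = 0.
Proof.
rewrite /rker enorm0 powR0 ?invr0// predE pnatr_eq0.
by case: n hn => [|[]].
Qed.

Lemma rkerN z : rker (- z) = rker z.
Proof. by rewrite /rker enormN. Qed.

Lemma rker_le z (s : R) : 0 < s -> s <= `|z| -> rker z <= (s ^+ n.-1)^-1.
Proof.
move=> s0 sz; have sE : s <= enorm z by apply: le_trans sz (norm_le_enorm z).
have E0 := lt_le_trans s0 sE.
rewrite /rker predE powR_mulrn ?enorm_ge0// lef_pV2 ?posrE ?exprn_gt0//.
by rewrite lerXn2r ?nnegrE ?(ltW s0) ?(ltW E0).
Qed.

Lemma measurable_rker : measurable_fun [set: borelRV R n] (rker : borelRV R n -> R).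
Proof.
rewrite (_ : rker = (fun t : R => t `^ (- (n%:R - 1))) \o (enorm : borelRV R n -> R)).
  exact: measurableT_comp (measurable_powR _) measurable_enorm.
by apply/funext => z /=; rewrite powRN.
Qed.

Lemma dyadic_shell (N : R) z : 0 < N -> z != 0 -> `|z| < N ->
  exists j, N / 2 ^+ j.+1 <= `|z| /\ `|z| < N / 2 ^+ j.
Proof.
move=> N0 z0 zN; have z1 : 0 < `|z| by rewrite normr_gt0.
have ex : exists j, N / 2 ^+ j <= `|z|.
  exists (Num.bound (N / `|z|)); rewrite ler_pdivrMr ?exprn_gt0// mulrC -ler_pdivrMr//.
  apply: (@le_trans _ _ (Num.bound (N / `|z|))%:R).
    apply: le_trans (ler_norm _) _; apply: ltW.
    have := @archi_boundP R (N / `|z|); rewrite ger0_norm ?divr_ge0 ?(ltW N0)//; exact.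
  by rewrite -natrX ler_nat ltnW// ltn_expl.
case: (ex_minnP ex) => -[|j] jz jmin.
  by move: jz; rewrite expr0 divr1 leNgt zN.
exists j; split => //; rewrite ltNge; apply/negP => /jmin; by rewrite ltnn.
Qed.

(** On a dyadic shell the kernel is at most its bound at the inner radius. Enlarging the shell to
    the whole box adds only nonnegative terms and makes the volume explicit. *)
Lemma rker_series_bound (N : R) z : 0 < N ->
  ((\1_(box N) z * rker z)%:E <=
   \sum_(j <oo) (((N / 2 ^+ j.+1) ^+ n.-1)^-1 * \1_(box (N / 2 ^+ j)) z)%:E)%E.
Proof.
move=> N0.
have c0 j : 0 <= ((N / 2 ^+ j.+1) ^+ n.-1)^-1 :> R.
  by rewrite invr_ge0 exprn_ge0// divr_ge0 ?exprn_ge0// (ltW N0).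
have h0 (j : nat) : xpredT j ->
    (0 <= (((N / 2 ^+ j.+1) ^+ n.-1)^-1 * \1_(box (N / 2 ^+ j)) z)%:E)%E.
  by move=> _; rewrite lee_fin mulr_ge0 ?c0 ?indicE.
have [z0|z0] := eqVneq z 0.
  rewrite [rker z](_ : _ = 0) ?mulr0; last by rewrite z0 rker0.
  by apply: nneseries_ge0 => j _ /h0.
have [zN|zN] := ltP `|z| N; last first.
  rewrite indicE memNset ?mul0r; last by rewrite /box/=; apply/negP; rewrite -leNgt.
  by apply: nneseries_ge0 => j _ /h0.
have [j [j1 j2]] := dyadic_shell N0 z0 zN.
apply: (@le_trans _ _ (\sum_(0 <= i < j.+1)
    (((N / 2 ^+ i.+1) ^+ n.-1)^-1 * \1_(box (N / 2 ^+ i)) z)%:E)%E).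
  rewrite big_nat_recr//= -[leLHS]add0e; apply: leeD.
    by apply: sume_ge0 => i _; exact: h0.
  rewrite lee_fin !indicE !mem_set// mul1r mulr1; apply: rker_le => //.
  by rewrite divr_gt0// exprn_gt0.
by apply: nneseries_lim_ge => i /h0.
Qed.

Lemma rker_integral (N : R) : 0 < N ->
  (\int[leb]_z (\1_(box N) z * rker z)%:E <= (4 ^+ n * N)%:E)%E.
Proof.
move=> N0.
pose u j z := (((N / 2 ^+ j.+1) ^+ n.-1)^-1 * \1_(box (N / 2 ^+ j)) z)%:E.
have u0 j z : (0 <= u j z)%E.
  by rewrite lee_fin mulr_ge0// invr_ge0 exprn_ge0// divr_ge0 ?exprn_ge0// (ltW N0).
have mu j : measurable_fun setT (u j : borelRV R n -> \bar R).
  apply/measurable_EFinP; apply: measurable_funM => //.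
  by apply: measurable_indic; exact: measurable_box.
apply: (@le_trans _ _ (\int[leb]_z (\sum_(j <oo) u j z))%E).
  apply: ge0_le_integral => //.
  - by move=> z _; rewrite lee_fin mulr_ge0// rker_ge0.
  - apply/measurable_EFinP; apply: measurable_funM; last exact: measurable_rker.
    by apply: measurable_indic; exact: measurable_box.
  - by apply: ge0_emeasurable_sum.
  - by move=> z _; exact: rker_series_bound.
rewrite integral_nneseries//.
(* With [a = N / 2^(j+1)], term [j] equals [(4 a)^n / a^(n-1) = 4^n a], and these [a] sum to [N]. *)
rewrite (@eq_eseriesr _ _ (fun j => ((4 ^+ n * N) / (2 ^ (j + 1))%:R)%:E)).
  by rewrite (cvg_lim _ (@cvg_geometric_eseries_half R (4 ^+ n * N) 0))// expr0 divr1.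
move=> j _; rewrite /u.
have N2 : 0 < N / 2 ^+ j by rewrite divr_gt0// exprn_gt0.
under eq_integral do rewrite EFinM.
rewrite ge0_integralZl//; last 2 first.
- by apply/measurable_EFinP/measurable_indic; exact: measurable_box.
- by rewrite lee_fin invr_ge0 exprn_ge0// divr_ge0 ?exprn_ge0// (ltW N0).
rewrite integral_indic//; last exact: measurable_box.
rewrite setIT [X in (_ * X)%E](_ : _ = ((2 * (N / 2 ^+ j)) ^+ n)%:E);
  last exact: lebesgue_box.
rewrite -EFinM; congr _%:E.
have e : n = n.-1.+1 by rewrite prednK// (leq_trans _ hn).
rewrite natrX addn1; set a := N / 2 ^+ j.+1.
have a0 : a != 0 by rewrite gt_eqF// divr_gt0// exprn_gt0.
have -> : 2 * (N / 2 ^+ j) = 4 * a.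
  by rewrite /a exprS; field; rewrite expf_eq0 pnatr_eq0 andbF.
have -> : 4 ^+ n * N / 2 ^+ j.+1 = 4 ^+ n * a by rewrite /a mulrA.
clearbody a; rewrite exprMn mulrCA; congr (_ * _).
have -> : a ^+ n = a ^+ n.-1 * a by rewrite -exprSr -e.
by rewrite mulKf// expf_eq0 (negbTE a0) andbF.
Qed.

Let bounded_int (H : 'rV[R]_n -> R) (c N : R) : 0 < N ->
  measurable_fun [set: borelRV R n] (H : borelRV R n -> R) ->
  (forall z, `|H z| <= c * \1_(box N) z) ->
  leb.-integrable setT (fun z => (H z * rker z)%:E) /\
  (\int[leb]_z `|(H z * rker z)%:E| <= (c * (4 ^+ n * N))%:E)%E.
Proof.
move=> N0 mH HN.
have c0 : 0 <= c.
  have := HN 0; rewrite indicE mem_set ?mulr1; first by apply: le_trans.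
  by rewrite /box/= normr0.
have mHr : measurable_fun setT (fun z : borelRV R n => (H z * rker z)%:E).
  by apply/measurable_EFinP; apply: measurable_funM => //; exact: measurable_rker.
have h : (\int[leb]_z `|(H z * rker z)%:E| <= (c * (4 ^+ n * N))%:E)%E.
  rewrite EFinM.
  apply: (@le_trans _ _ (c%:E * \int[leb]_z (\1_(box N) z * rker z)%:E)%E); last first.
    by rewrite lee_wpmul2l ?lee_fin// rker_integral.
  rewrite -ge0_integralZl//; last 2 first.
  - apply/measurable_EFinP; apply: measurable_funM; last exact: measurable_rker.
    by apply: measurable_indic; exact: measurable_box.
  - by move=> z _; rewrite lee_fin mulr_ge0// rker_ge0.
  apply: ge0_le_integral => //.
  - exact: measurableT_comp.
  - apply/measurable_EFinP; apply: measurable_funM => //.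
    apply: measurable_funM; last exact: measurable_rker.
    by apply: measurable_indic; exact: measurable_box.
  move=> z _; rewrite abse_EFin -EFinM lee_fin normrM (ger0_norm (rker_ge0 z)) mulrA.
  by apply: ler_wpM2r (HN z); exact: rker_ge0.
split => //; apply/integrableP; split => //.
by apply: le_lt_trans h _; rewrite ltry.
Qed.

(** Every limit passage for potentials reduces to a bound [c * (4 ^+ n * N)] on a smear, with [N]
    fixed and [c] small. *)
Definition smear (H : 'rV[R]_n -> R) : R := \int[leb]_z (H z * rker z).

Lemma smear_integrable (H : 'rV[R]_n -> R) (c N : R) : 0 < N ->
  measurable_fun [set: borelRV R n] (H : borelRV R n -> R) ->
  (forall z, `|H z| <= c * \1_(box N) z) ->
  leb.-integrable setT (fun z => (H z * rker z)%:E).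
Proof. by move=> N0 mH /(bounded_int N0 mH)[]. Qed.

Lemma smear_bound (H : 'rV[R]_n -> R) (c N : R) : 0 < N ->
  measurable_fun [set: borelRV R n] (H : borelRV R n -> R) ->
  (forall z, `|H z| <= c * \1_(box N) z) ->
  `|smear H| <= c * (4 ^+ n * N).
Proof.
move=> N0 mH /(bounded_int N0 mH)[iH Hc].
rewrite -lee_fin; apply: le_trans Hc; rewrite /smear EFin_normr_Rintegral//.
by apply: le_abse_integral => //; case/integrableP: iH.
Qed.

End kernel.

(** * Riesz potentials of compactly supported functions *)

Section compact_support.
Context {R : realType} {n : nat}.
Implicit Types (x y z : 'rV[R]_n) (g f : 'rV[R]_n -> R).

Definition vanishes_off g (M : R) := forall z, M <= `|z| -> g z = 0.

Lemma compact_closed_box (M : R) : compact [set z : 'rV[R]_n | `|z| <= M].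
Proof.
apply: bounded_closed_compact.
  exists M; split; first exact: num_real.
  move=> r Mr z /= zM; apply: le_trans zM (ltW Mr).
rewrite (_ : mkset _ = (fun z : 'rV[R]_n => `|z|) @^-1` [set r | r <= M])//.
apply: closed_comp => [z _|]; [exact: norm_continuous|exact: closed_le].
Qed.

(** Compactness, in near-covering form, is applied on the box of radius [M + 1]: beyond it, two
    points at distance less than 1 both lie where [g] vanishes. *)
Lemma uniform_continuity g (M : R) : continuous g -> vanishes_off g M ->
  forall e : R, 0 < e -> exists2 d : R, 0 < d &
  forall x y, `|x - y| < d -> `|g x - g y| <= e.
Proof.
move=> cg gM e e0.
have := @compact_closed_box (M + 1); rewrite compact_near_coveringP.
move=> /(_ R (0 : R)^'+ (fun d x => forall y, `|x - y| < d -> `|g x - g y| <= e)).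
case.
  move=> x _.
  have /cvgrPdist_lt/(_ (e / 2)) := cg x.
  rewrite divr_gt0// => /(_ isT) /nbhs_ballP[r /= r0 rg].
  exists (ball x (r / 2), [set d : R | 0 < d < r / 2]) => /=.
    split; first by apply: nbhsx_ballx; rewrite divr_gt0.
    exists (r / 2); first by rewrite /= divr_gt0.
    move=> d /=; rewrite sub0r normrN => dr d0; rewrite d0/=.
    by rewrite gtr0_norm in dr.
  move=> [x' d] /= [xx' /andP[d0 dr]] y x'y.
  have h1 : `|g x - g x'| < e / 2.
    by apply: rg; apply: le_ball xx'; rewrite ler_pdivrMr// ler_pMr// ler1n.
  have h2 : `|g x - g y| < e / 2.
    apply: rg; rewrite [r]splitr; apply: ball_triangle xx' _.
    by rewrite -ball_normE /ball_/=; apply: lt_trans x'y dr.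
  rewrite (_ : g x' - g y = (g x - g y) - (g x - g x')); last by ring.
  apply: le_trans (ler_normB _ _) _; rewrite [leRHS]splitr.
  by apply: lerD; exact: ltW.
move=> d0 /= d00 hd.
exists (Num.min (d0 / 2) 1).
  by rewrite lt_min ltr01 andbT divr_gt0.
move=> x y; rewrite lt_min => /andP[xy xy1].
have [xM|xM] := leP `|x| (M + 1).
  apply: (hd (d0 / 2)) => //=; last by rewrite divr_gt0.
  rewrite sub0r normrN gtr0_norm ?divr_gt0//.
  by rewrite ltr_pdivrMr// ltr_pMr// ltr1n.
rewrite !gM ?subrr ?normr0 ?(ltW e0)//.
  have := ler_normD (x - y) y; rewrite subrK; lra.
by lra.
Qed.

Lemma vanishing_bounded g (M : R) : continuous g -> vanishes_off g M ->
  exists2 c : R, 0 <= c & forall x, `|g x| <= c.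
Proof.
move=> cg gM.
have : compact (g @` [set z : 'rV[R]_n | `|z| <= M]).
  apply: continuous_compact; last exact: compact_closed_box.
  exact: continuous_subspaceT.
move=> /compact_bounded[c [_ /(_ (`|c| + 1))]] h.
exists (`|c| + 1); first by rewrite addr_ge0.
move=> x; have [xM|xM] := leP `|x| M.
  by apply: h; [rewrite (le_lt_trans (ler_norm c))// ltrDl|exists x].
by rewrite gM ?(ltW xM)// normr0 addr_ge0.
Qed.

Lemma line_derive g i x (t : R) : derivable g (x + t *: delta_mx ord0 i) (delta_mx ord0 i) ->
  is_derive t (1 : R) (fun s : R => g (x + s *: delta_mx ord0 i))
    (partial i g (x + t *: delta_mx ord0 i)).
Proof.
move=> dg; set e := delta_mx ord0 i in dg *.
have E : (fun h : R => h^-1 *: ((fun s : R => g (x + s *: e)) (h *: (1 : R) + t) - g (x + t *: e)))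
    = (fun h : R => h^-1 *: (g (h *: e + (x + t *: e)) - g (x + t *: e))).
  apply/funext => h; congr (_ *: (g _ - _)).
  by rewrite [h *: 1]mulr1 scalerDl addrCA.
by split; [rewrite /derivable /= E|rewrite /partial /derive /= E].
Qed.

Lemma mean_value_partial g i : continuous (partial i g) ->
  (forall x, derivable g x (delta_mx ord0 i)) ->
  forall x (h : R), exists2 y, `|y - x| <= `|h| &
    g (x + h *: delta_mx ord0 i) - g x = h * partial i g y.
Proof.
move=> cp dg; set e := delta_mx ord0 i.
suff pos x (h : R) : 0 < h -> exists2 s, 0 <= s <= h &
    g (x + h *: e) - g x = h * partial i g (x + s *: e).
  move=> x h; have [h0|h0|->] := ltgtP h 0.
  (* For negative [h] the end points are swapped: step [- h] from [x + h *: e]. *)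
  - have [|s /andP[s0 sh] gs] := pos (x + h *: e) (- h); first by rewrite oppr_gt0.
    exists (x + h *: e + s *: e).
      rewrite -[x + _ + _]addrA [x + _]addrC addrK -scalerDl norm_scale_delta.
      by rewrite (ltr0_norm h0) ler_norml; apply/andP; split; lra.
    move: gs; rewrite -addrA -scalerDl subrr scale0r addr0 mulNr => gs.
    by rewrite -opprB gs opprK.
  - have [s /andP[s0 sh] gs] := pos x h h0.
    exists (x + s *: e) => //.
    by rewrite addrC addKr norm_scale_delta ger0_norm// (gtr0_norm h0).
  - by exists x; rewrite ?subrr ?normr0// scale0r addr0 subrr mul0r.
move=> h0; pose phi (s : R) := g (x + s *: e).
have dphi (s : R) : is_derive s (1 : R) phi (partial i g (x + s *: e)) by exact: line_derive.
have cphi : {within `[0, h], continuous phi}.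
  by apply: derivable_within_continuous => s _; exact: ex_derive.
have [s sh E] := MVT h0 (fun s _ => dphi s) cphi.
move: sh; rewrite in_itv/= => /andP[s0 sh].
exists s; first by rewrite !ltW.
by move: E; rewrite /phi scale0r addr0 subr0 mulrC.
Qed.

End compact_support.

(** * Continuity, differentiation and decay of the unnormalised potential *)

Section potential.
Context {R : realType} {n : nat}.
Hypothesis hn : (2 <= n)%N.
Implicit Types (x y z : 'rV[R]_n) (f g : 'rV[R]_n -> R).
Local Notation leb := (lebesgueRV R n).
Local Notation box := (@box R n).

(** The convolution after the substitution [y = x + z]: the variable [x] sits in the regular factor,
    so differences in [x] are smears of differences of [g] and the singularity never moves. *)
Definition raw_potential g x : R := smear (fun z => g (x + z)).

Let tame g := continuous g /\ exists2 M, 0 < M & vanishes_off g M.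

Let measurable_translate g x : continuous g ->
  measurable_fun [set: borelRV R n] ((fun z => g (x + z)) : borelRV R n -> R).
Proof.
by move=> cg; exact: measurableT_comp (continuous_measurableRV cg) (measurable_addlRV x).
Qed.

Lemma vanishes_translate g (M N : R) x z : vanishes_off g M -> `|x| < N ->
  M + N <= `|z| -> g (x + z) = 0.
Proof.
move=> gM xN zMN; apply: gM; have := ler_normD (x + z) (- x).
by rewrite addrAC subrr add0r normrN; lra.
Qed.

Let raw_potential_integrable g x : tame g -> leb.-integrable setT (fun z => (g (x + z) * rker z)%:E).
Proof.
move=> [cg [M M0 gM]]; have [c c0 gc] := vanishing_bounded cg gM.
have N0 : 0 < M + (`|x| + 1) by rewrite addr_gt0// ltr_wpDl.
apply: (smear_integrable hn N0 (measurable_translate x cg) (c := c)) => z.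
rewrite indicE; have [_|/negP zB] := boolP (z \in _); first by rewrite mulr1.
rewrite mulr0 (vanishes_translate gM (N := `|x| + 1)) ?normr0 ?ltrDl//.
by rewrite leNgt; apply/negP => h; apply: zB; rewrite inE.
Qed.

Lemma raw_potential_uniform_continuity g (M N : R) : 0 < M -> 0 < N -> continuous g -> vanishes_off g M ->
  forall e : R, 0 < e -> exists2 d : R, 0 < d &
  forall x y, `|x| < N -> `|y| < N -> `|x - y| < d -> `|raw_potential g x - raw_potential g y| <= e.
Proof.
move=> M0 N0 cg gM e e0.
have K0 : 0 < 4 ^+ n * (M + N) by rewrite mulr_gt0 ?exprn_gt0 ?addr_gt0.
have [d d0 gd] := uniform_continuity cg gM (divr_gt0 e0 K0).
exists d => // x y xN yN xy.
have tg : tame g by split=> //; exists M.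
rewrite /raw_potential /smear -RintegralB//; try exact: raw_potential_integrable.
have -> : \int[leb]_z (g (x + z) * rker z - g (y + z) * rker z) =
    smear (fun z => g (x + z) - g (y + z)).
  by apply: eq_Rintegral => z _; rewrite mulrBl.
apply: le_trans (smear_bound hn (c := e / (4 ^+ n * (M + N))) (N := M + N) _ _ _) _.
- exact: addr_gt0.
- by apply: measurable_funB; exact: measurable_translate.
- move=> z; rewrite indicE; have [_|/negP zB] := boolP (z \in _).
    by rewrite mulr1; apply: gd; rewrite opprD addrACA subrr addr0.
  have zMN : M + N <= `|z| by rewrite leNgt; apply/negP => h; apply: zB; rewrite inE.
  by rewrite !(vanishes_translate gM _ zMN)// subrr normr0 mulr0.
by rewrite divfK// gt_eqF.
Qed.

(** The margin 1 gives each point considered a neighbourhood, along direction [i], on which [g] is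
    0. *)
Lemma vanishes_partial g (M : R) i : vanishes_off g M -> vanishes_off (partial i g) (M + 1).
Proof.
move=> gM z zM; rewrite /partial /derive.
apply: lim_near_cst => //.
near=> h.
have h1 : `|h| < 1 by near: h; apply: dnbhs0_lt.
rewrite /= (gM z) ?(gM (_ + z)) ?subrr ?scaler0//; last by lra.
have := ler_normD (h *: delta_mx ord0 i + z) (- (h *: delta_mx ord0 i)).
by rewrite addrAC subrr add0r normrN norm_scale_delta; lra.
Unshelve. all: by end_near. Qed.

(** Difference quotients of [f] converge uniformly to [partial i f], by the mean value theorem and
    uniform continuity, with supports in a common box; [smear_bound] carries this through the
    integral. *)
Lemma derive_raw_potential f i x : Ck 1 f -> (exists2 M, 0 < M & vanishes_off f M) ->
  is_derive x (delta_mx ord0 i) (raw_potential f) (raw_potential (partial i f) x).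
Proof.
move=> [cf /(_ i)[df cpf]] [M M0 fM].
have tf : tame f by split=> //; exists M.
have pM := vanishes_partial i fM.
have tp : tame (partial i f) by split=> //; exists (M + 1) => //; rewrite addr_gt0.
set e := delta_mx ord0 i.
suff H : (fun h : R => h^-1 *: (raw_potential f (h *: e + x) - raw_potential f x)) @ 0^' -->
    raw_potential (partial i f) x.
  by apply: DeriveDef; [apply/cvg_ex; eexists; exact: H|exact/cvg_lim].
apply/cvgrPdist_le => eps eps0.
pose N := `|x| + 1; have N0 : 0 < N by rewrite ltr_wpDl.
(* [M + 1] is the support radius of the partial derivative; [N + 1] bounds both [x] and [h *: e + x]
   when [|h| < 1]. *)
pose L := M + 1 + (N + 1).
have L0 : 0 < L by rewrite /L; lra.
have K0 : 0 < 4 ^+ n * L by rewrite mulr_gt0 ?exprn_gt0.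
have [d d0 pd] := uniform_continuity cpf pM (divr_gt0 eps0 K0).
near=> h.
have h0 : h != 0 by near: h; exact: nbhs_dnbhs_neq.
have h1 : `|h| < 1 by near: h; apply: dnbhs0_lt.
have hd : `|h| < d by near: h; apply: dnbhs0_lt.
pose H z := partial i f (x + z) - h^-1 * (f (h *: e + x + z) - f (x + z)).
have -> : raw_potential (partial i f) x - h^-1 *: (raw_potential f (h *: e + x) - raw_potential f x) = smear H.
  have i1 := raw_potential_integrable (h *: e + x) tf.
  have i2 := raw_potential_integrable x tf.
  have i3 := raw_potential_integrable x tp.
  have i4 := integrableB measurableT i1 i2.
  have i5 := integrableZl measurableT h^-1 i4.
  rewrite (_ : raw_potential f (h *: e + x) - raw_potential f x = \int[leb]_z
    (f (h *: e + x + z) * rker z - f (x + z) * rker z)); last by rewrite RintegralB.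
  rewrite (_ : h^-1 *: _ = \int[leb]_z (h^-1 *
    (f (h *: e + x + z) * rker z - f (x + z) * rker z))); last by rewrite RintegralZl.
  rewrite -RintegralB//.
  by apply: eq_Rintegral => z _; rewrite /H; ring.
apply: le_trans (smear_bound hn (c := eps / (4 ^+ n * L)) (N := L) _ _ _) _.
- by [].
- apply: measurable_funB; first exact: measurable_translate.
  apply: measurable_funM => //.
  by apply: measurable_funB; exact: measurable_translate.
- move=> z; rewrite indicE; have [_|/negP zB] := boolP (z \in _).
    rewrite mulr1 /H.
    have [y yz E] := mean_value_partial cpf df (x + z) h.
    rewrite -[h *: e + x + z]addrA [h *: e + _]addrC E mulKf//; apply: pd.
    by rewrite distrC; apply: le_lt_trans yz hd.
  have zL : L <= `|z| by rewrite leNgt; apply/negP => h2; apply: zB; rewrite inE.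
  have xN : `|x| < N by rewrite ltrDl.
  have hxN : `|h *: e + x| < N + 1.
    apply: le_lt_trans (ler_normD _ _) _; rewrite norm_scale_delta /N; lra.
  rewrite /H (vanishes_translate pM xN) ?(vanishes_translate fM xN)
    ?(vanishes_translate fM hxN); try by move: zL; rewrite /L; lra.
  by rewrite subrr mulr0 subr0 normr0 mulr0.
by rewrite divfK// gt_eqF.
Unshelve. all: by end_near. Qed.

(** Far from the support the kernel is at most [1 / r^(n-1) <= 1 / r] wherever [g (x + z)] is
    nonzero, and the support has finite volume. *)
Lemma raw_potential_decay g : continuous g -> (exists2 M, 0 < M & vanishes_off g M) ->
  forall e : R, 0 < e -> exists2 N : R, 0 < N & forall x, N <= `|x| -> `|raw_potential g x| <= e.
Proof.
move=> cg [M M0 gM] e e0; have [c c0 gc] := vanishing_bounded cg gM.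
have tg : tame g by split=> //; exists M.
pose V := (2 * M) ^+ n.
have V0 : 0 < V by rewrite exprn_gt0// mulr_gt0.
(* The quotient makes [c * V / r <= e]; the added 1 makes [r >= 1], so that [r <= r^(n-1)] as
   [n >= 2]. *)
pose r := c * V / e + 1.
have r1 : 1 <= r by rewrite lerDr divr_ge0 ?mulr_ge0 ?(ltW V0) ?(ltW e0).
have r0 : 0 < r by apply: lt_le_trans r1.
exists (M + r) => [|x xM]; first by rewrite addr_gt0.
have rn : r <= r ^+ n.-1.
  by case: n hn => [|[|m]] //= _; rewrite exprS ler_peMr ?(ltW r0)// exprn_ege1.
rewrite -lee_fin /raw_potential /smear EFin_normr_Rintegral//; last exact: raw_potential_integrable.
have mB : measurable_fun [set: borelRV R n] (fun y => (\1_(box M) y)%:E : \bar R).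
  by apply/measurable_EFinP/measurable_indic; exact: measurable_box.
have mg : measurable_fun [set: borelRV R n] (fun z => (g (x + z) * rker z)%:E).
  by case/integrableP: (raw_potential_integrable x tg).
apply: le_trans (le_abse_integral _ _ _) _ => //.
apply: (@le_trans _ _ (\int[leb]_z ((c / r)%:E * (\1_(box M) (x + z))%:E))%E).
  apply: ge0_le_integral => //.
  - exact: measurableT_comp.
  - apply: emeasurable_funM => //.
    exact: (measurableT_comp mB (measurable_addlRV x)).
  move=> z _; rewrite abse_EFin -EFinM lee_fin normrM (ger0_norm (rker_ge0 z)) indicE.
  have [xz|/negP xz] := boolP (x + z \in _); last first.
    rewrite gM ?normr0 ?mul0r ?mulr0// leNgt; apply/negP => h; apply: xz.
    by rewrite inE.
  rewrite mulr1 ler_pM ?rker_ge0// ?gc//.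
  have rz : r <= `|z|.
    have xzM : `|x + z| < M by move: xz; rewrite inE.
    have := ler_normD (x + z) (- z); rewrite addrK normrN; lra.
  apply: le_trans (rker_le hn r0 rz) _.
  by rewrite lef_pV2 ?posrE ?exprn_gt0.
rewrite ge0_integralZl//; last 2 first.
- exact: (measurableT_comp mB (measurable_addlRV x)).
- by rewrite lee_fin divr_ge0// ltW.
rewrite (ge0_integral_translationRV x mB)//.
rewrite integral_indic//; last exact: measurable_box.
rewrite setIT [X in (_ * X)%E](_ : _ = V%:E); last exact: lebesgue_box.
rewrite -EFinM lee_fin mulrAC ler_pdivrMr// /r mulrDr mulr1 mulrCA divff ?gt_eqF//.
by rewrite mulr1 lerDl ltW.
Qed.

Lemma riesz_potentialE f x : continuous f ->
  riesz_potential 1 f x = (@riesz_constant R n 1)^-1 * raw_potential f x.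
Proof.
move=> cf.
suff E : \int[leb]_y (f y / enorm (x - y) `^ (n%:R - 1)) = raw_potential f x by rewrite -E.
have mF : measurable_fun [set: borelRV R n] (fun y => f y / enorm (x - y) `^ (n%:R - 1)).
  apply: measurable_funM; first exact: continuous_measurableRV.
  rewrite (_ : (fun y => _) = rker \o (fun y => - x + y)); last first.
    by apply/funext => y /=; rewrite -rkerN opprD opprK.
  exact: measurableT_comp measurable_rker (measurable_addlRV (- x)).
rewrite -(Rintegral_translationRV x mF); apply: eq_Rintegral => z _.
by rewrite /rker opprD addrA subrr add0r enormN.
Qed.

End potential.

(** * The regularity of the potential that the grid argument uses *)

Section regularity.
Context {R : realType} {n : nat}.
Implicit Types (x y : 'rV[R]_n) (u : 'rV[R]_n -> R).

(** On each bounded box a single modulus [d] serves [u] and all its partial derivatives, so one mesh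
    controls them together. *)
Definition locally_C1_decaying u :=
  [/\ forall i x, derivable u x (delta_mx ord0 i),
      forall N e : R, 0 < N -> 0 < e -> exists2 d : R, 0 < d &
        forall x y, `|x| < N -> `|y| < N -> `|x - y| < d ->
          `|u x - u y| <= e /\ forall i, `|partial i u x - partial i u y| <= e &
      forall e : R, 0 < e -> exists2 N : R, 0 < N & forall x, N <= `|x| -> `|u x| <= e].

Lemma test_function_vanishes u : test_function u -> exists2 M : R, 0 < M & vanishes_off u M.
Proof.
move=> [_ /compact_bounded[c [_ /(_ (`|c| + 1))]]] h.
exists (`|c| + 2); first by rewrite ltr_wpDl.
move=> z zc; apply/eqP; apply: contrapT => /negP uz.
have : `|z| <= `|c| + 1.
  apply: h; first by rewrite (le_lt_trans (ler_norm c))// ltrDl.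
  exact: subset_closure.
by move: zc; lra.
Qed.

Lemma potential_regular f : (2 <= n)%N -> test_function f ->
  locally_C1_decaying (@riesz_potential R n 1 f).
Proof.
move=> hn tf; have [M M0 fM] := test_function_vanishes tf.
have C1f : Ck 1 f by case: tf => /(_ 1%N).
have [cf pf] := C1f.
have [k uE] : exists k, riesz_potential 1 f = k \*: (raw_potential f : 'rV[R]_n -> R^o).
  by exists (@riesz_constant R n 1)^-1; apply/funext => x; rewrite riesz_potentialE.
rewrite {}uE; set u := _ \*: _.
have D i x : is_derive x (delta_mx ord0 i) u (k * raw_potential (partial i f) x).
  have DD := derive_raw_potential hn i x C1f (ex_intro2 _ _ M M0 fM).
  exact: (is_deriveZ k DD).
have pE i x : partial i u x = k * raw_potential (partial i f) x.
  by have := D i x => -[_ <-].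
have uE x : u x = k * raw_potential f x by [].
clearbody u.
have k0 : 0 < `|k| + 1 by rewrite ltr_wpDl.
have kle (e a b : R) : `|a - b| <= e / (`|k| + 1) -> `|k * a - k * b| <= e.
  rewrite ler_pdivlMr// -mulrBr normrM => h; apply: le_trans h.
  by rewrite mulrC; apply: ler_wpM2l => //; rewrite lerDl.
split.
- by move=> i x; have [] := D i x.
- move=> N e N0 e0; have ek : 0 < e / (`|k| + 1) by rewrite divr_gt0.
  have [d d0 cd] := raw_potential_uniform_continuity hn M0 N0 cf fM ek.
  have /choice[d' d'P] (i : 'I_n) : exists d' : R, 0 < d' /\ forall x y,
      `|x| < N -> `|y| < N -> `|x - y| < d' ->
      `|raw_potential (partial i f) x - raw_potential (partial i f) y| <= e / (`|k| + 1).
    have M1 : 0 < M + 1 by rewrite addr_gt0.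
    have [d1 d10 h] := raw_potential_uniform_continuity hn M1 N0 (pf i).2 (vanishes_partial i fM) ek.
    by exists d1.
  exists (\big[Num.min/d]_(i < n) d' i).
    by apply/bigmin_gtP; split => // i _; have [] := d'P i.
  move=> x y xN yN /bigmin_gtP[xyd xyd']; split.
    by rewrite !uE; apply: kle; exact: cd.
  by move=> i; rewrite !pE; apply: kle; have [_] := d'P i; apply => //; exact: xyd'.
- move=> e e0; have ek : 0 < e / (`|k| + 1) by rewrite divr_gt0.
  have [|N N0 h] := raw_potential_decay hn cf _ ek; first by exists M.
  exists N => // x /h hx; rewrite uE.
  by have := kle e (raw_potential f x) 0; rewrite !mulr0 !subr0; apply.
Qed.

End regularity.

(** * Dyadic boxes and their weights *)

Section dyadic_boxes.
Context {R : realType} {n : nat}.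
Variable N : R.
Implicit Types (s : R) (k p : 'I_n -> nat) (x z : 'rV[R]_n).

(** The grid starts at the corner [(-N, ..., -N)], which keeps the indices in [nat]. *)
Definition node s k : 'rV[R]_n := \row_i (- N + s * (k i)%:R).

(** Half-open sides make the boxes of one mesh pairwise disjoint without leaving gaps. *)
Definition gbox s k : set (borelRV R n) :=
  [set x : 'rV[R]_n | forall i, x ord0 i \in `[(- N + s * (k i)%:R), (- N + s * (k i).+1%:R)[].

Lemma gboxP s k x : gbox s k x <->
  forall i, - N + s * (k i)%:R <= x ord0 i < - N + s * (k i)%:R + s.
Proof.
split=> h i; have := h i; rewrite /gbox /= in_itv/= -natr1 mulrDr mulr1 addrA; exact.
Qed.

Lemma measurable_gbox s k : measurable (gbox s k).
Proof.
rewrite (_ : gbox s k = \bigcap_(i in [set: 'I_n]) ((fun v : borelRV R n => v ord0 i) @^-1`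
   `[(- N + s * (k i)%:R), (- N + s * (k i).+1%:R)[%classic)).
  apply: fin_bigcap_measurable => // i _; rewrite -[X in measurable X]setTI.
  exact: measurable_coord.
by apply/seteqP; split => [v Av i _|v Av i]; exact: Av.
Qed.

Lemma lebesgue_gbox s k : 0 < s -> lebesgueRV R n (gbox s k) = (s ^+ n)%:E.
Proof.
move=> s0; have := @lebesgueRV_box R n
  (fun i => `[(- N + s * (k i)%:R), (- N + s * (k i).+1%:R)[%classic) (fun i => measurable_itv _).
move=> ->.
under eq_bigr => i _.
  rewrite lebesgue_measure_itv/= lte_fin ltrD2l ltr_pM2l// ltr_nat ltnSn.
  rewrite -EFinB (_ : _ - _ = s); last by rewrite -natr1; ring.
  over.
by rewrite prodEFin prodr_const card_ord.
Qed.

Lemma gbox_child s (m : nat) k p : 0 < s -> (forall i, p i < m)%N ->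
  gbox s (cube_pt m k p) `<=` gbox (m%:R * s) k.
Proof.
move=> s0 pm x /gboxP h; apply/gboxP => i; have /andP[h1 h2] := h i.
have p1 : (p i)%:R + 1 <= m%:R :> R by rewrite natr1 ler_nat.
have e : s * (cube_pt m k p i)%:R = m%:R * s * (k i)%:R + s * (p i)%:R.
  by rewrite /cube_pt natrD natrM; ring.
have e2 : s * ((p i)%:R + 1) = s * (p i)%:R + s by ring.
have := ler_wpM2l (ltW s0) p1; have : 0 <= s * (p i)%:R by rewrite mulr_ge0// ltW.
rewrite e2 (mulrC s m%:R) => h3 h4; move: h1 h2; rewrite e => h1 h2.
by apply/andP; split; lra.
Qed.

Lemma gbox_inj s k p x : 0 < s -> gbox s k x -> gbox s p x -> k = p.
Proof.
move=> s0 /gboxP hk /gboxP hp; apply/funext => i.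
have /andP[k1 k2] := hk i; have /andP[p1 p2] := hp i.
have lt1 : s * (k i)%:R < s * (p i).+1%:R by rewrite -natr1 mulrDr mulr1; lra.
have lt2 : s * (p i)%:R < s * (k i).+1%:R by rewrite -natr1 mulrDr mulr1; lra.
by move: lt1 lt2; rewrite !ltr_pM2l// !ltr_nat; lia.
Qed.

Lemma gbox_dist s k x z : 0 < s -> gbox s k x -> gbox s k z -> `|x - z| < s.
Proof.
move=> s0 /gboxP hx /gboxP hz; apply/rV_norm_lt => // i.
have /andP[x1 x2] := hx i; have /andP[z1 z2] := hz i.
by rewrite !mxE ltr_norml; apply/andP; split; lra.
Qed.

Lemma node_gbox s k : 0 < s -> gbox s k (node s k).
Proof. by move=> s0; apply/gboxP => i; rewrite mxE lexx/= ltrDl. Qed.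

Lemma node_succ_at s k i : node s (succ_at i k) = node s k + s *: delta_mx ord0 i.
Proof.
apply/rowP => j; rewrite !mxE eqxx/= /succ_at /upd; case: eqP => [->|_].
  by rewrite -natr1 mulr1n mulrDr mulr1 addrA.
by rewrite mulr0n mulr0 addr0.
Qed.

Lemma gbox_cover s (m : nat) x : 0 < s -> 
  (forall i, - N <= x ord0 i < - N + m%:R * s) ->
  exists q : {ffun 'I_n -> 'I_m}, gbox s (pt q) x.
Proof.
move=> s0 h.
have t0 i : 0 <= (x ord0 i + N) / s.
  by have /andP[h1 h2] := h i; rewrite divr_ge0 ?(ltW s0)//; lra.
have hi i : (Num.truncn ((x ord0 i + N) / s) < m)%N.
  have /andP[h1 h2] := h i; have /andP[t1 t2] := truncn_itv (t0 i).
  by rewrite -(ltr_nat R); apply: le_lt_trans t1 _; rewrite ltr_pdivrMr//; lra.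
exists [ffun i => Ordinal (hi i)]; apply/gboxP => i; rewrite /pt ffunE/=.
have /andP[h1 h2] := h i.
have /andP[] := truncn_itv (t0 i).
set t := Num.truncn _; rewrite ler_pdivlMr// ltr_pdivrMr// -natr1 => t1 t2.
have e : s * t%:R = t%:R * s by rewrite mulrC.
have e2 : (t%:R + 1) * s = t%:R * s + s by rewrite mulrDl mul1r.
by rewrite e2 in t2; rewrite e; apply/andP; split; lra.
Qed.

Section measure.
Variable mu : {measure set (borelRV R n) -> \bar R}.
Hypothesis hmu : locally_finite_measure mu.

Lemma mu_gbox_fin s k : 0 < s -> mu (gbox s k) \is a fin_num.
Proof.
move=> s0; rewrite ge0_fin_numE//; set x := node s k.
have cK := @compact_closed_box R n (`|x| + s).
apply: le_lt_trans (hmu cK).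
apply: le_measure; rewrite ?inE; first exact: measurable_gbox.
  rewrite -[X in measurable X]setCK; apply: measurableC; apply: sub_sigma_algebra.
  by apply: closed_openC; apply: compact_closed cK; exact: norm_hausdorff.
move=> z zk /=; have := gbox_dist s0 zk (node_gbox k s0); rewrite -/x => zx.
have := ler_normD (z - x) x; rewrite subrK; lra.
Qed.

Lemma mu_gbox_children s (m : nat) k : 0 < s -> (0 < m)%N ->
  \sum_(q : {ffun 'I_n -> 'I_m}) fine (mu (gbox s (cube_pt m k (pt q)))) <=
  fine (mu (gbox (m%:R * s) k)).
Proof.
move=> s0 m0; have ms0 : 0 < m%:R * s by rewrite mulr_gt0// ltr0n.
pose F (q : {ffun 'I_n -> 'I_m}) := gbox s (cube_pt m k (pt q)).
have tF : trivIset [set` enum {ffun 'I_n -> 'I_m}] F.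
  move=> q r _ _ [x [xq xr]]; apply/ffunP => i; apply: val_inj.
  have /(congr1 (@^~ i)) := gbox_inj s0 xq xr.
  by rewrite /cube_pt => /addnI.
have mF q : measurable (F q) by exact: measurable_gbox.
rewrite -lee_fin fineK; last exact: mu_gbox_fin.
rewrite -sumEFin.
under eq_bigr do rewrite fineK ?mu_gbox_fin//.
rewrite -big_enum (fsbig_seq _ _ (enum_uniq _)) -(@measure_fin_bigcup _ _ _ mu _ _ F)//.
apply: le_measure; rewrite ?inE.
- by apply: fin_bigcup_measurable => // q _.
- exact: measurable_gbox.
by move=> x [q _]; apply: gbox_child => // i; exact: ltn_ord.
Qed.

End measure.
End dyadic_boxes.

Lemma maximal1_ge0 (R : realType) n (mu : {measure set (borelRV R n) -> \bar R}) (z : 'rV[R]_n) :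
  (0 <= maximal1 mu z)%E.
Proof.
apply: (@le_trans _ _ (1%:E * mu (eball z 1) / lebesgueRV R n (eball z 1))%E).
  by rewrite mule_ge0 ?inve_ge0// mule_ge0.
by apply: ereal_sup_ubound; exists 1 => //=; rewrite in_itv/= ltr01.
Qed.

(** * Weights from dyadic ancestors, compared with the maximal function *)

Section weights.
Context {R : realType} {n : nat}.
Hypothesis n0 : (0 < n)%N.
Variables (N h : R) (D : nat).
Hypothesis h0 : 0 < h.
Variable mu : {measure set (borelRV R n) -> \bar R}.
Hypothesis hmu : locally_finite_measure mu.
Local Notation gbox := (@gbox R n N).

Definition ancestor j (p : 'I_n -> nat) : set (borelRV R n) :=
  gbox ((2 ^ j)%:R * h) (fun i => p i %/ 2 ^ j)%N.

(** The side is counted in cells, as on the grid; the power [h^(n-1)] that converts it to length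
    appears in [weight_maximal]. *)
Definition ancestor_density j p : R := fine (mu (ancestor j p)) / (2 ^ j)%:R ^+ n.-1.

Definition weight p : R := \big[Num.max/0]_(j < D.+1) ancestor_density j p.

Let pow0 j : 0 < (2 ^ j)%:R :> R.
Proof. by rewrite ltr0n expn_gt0. Qed.

Let side0 j : 0 < (2 ^ j)%:R * h.
Proof. by rewrite mulr_gt0. Qed.

Let density_ge0 j p : 0 <= ancestor_density j p.
Proof. by rewrite divr_ge0 ?fine_ge0// exprn_ge0. Qed.

Lemma weight_ge0 p : 0 <= weight p.
Proof. by rewrite /weight; elim/big_rec: _ => // j x _ x0; rewrite le_max x0 orbT. Qed.

Lemma ancestor_cube_pt j k (q : {ffun 'I_n -> 'I_(2 ^ j)}) :
  ancestor j (cube_pt (2 ^ j) k (pt q)) = gbox ((2 ^ j)%:R * h) k.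
Proof.
rewrite /ancestor; congr gbox; apply/funext => i; rewrite /cube_pt /pt.
by rewrite mulnC divnMDl ?expn_gt0// divn_small ?addn0.
Qed.

Lemma weight_frostman j k (q : {ffun 'I_n -> 'I_(2 ^ j)}) : (j <= D)%N ->
  \sum_(p : {ffun 'I_n -> 'I_(2 ^ j)}) fine (mu (gbox h (cube_pt (2 ^ j) k (pt p)))) <=
  weight (cube_pt (2 ^ j) k (pt q)) * (2 ^ j)%:R ^+ n.-1.
Proof.
move=> jD; apply: le_trans (@mu_gbox_children R n N mu hmu h (2 ^ j) k h0 _) _; first by rewrite expn_gt0.
rewrite -ler_pdivrMr ?exprn_gt0// -(ancestor_cube_pt k q).
have jD1 : (j < D.+1)%N by [].
exact: (le_bigmax _ (fun l : 'I_D.+1 => ancestor_density l (cube_pt (2 ^ j) k (pt q)))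
  (Ordinal jD1)).
Qed.

(** Replace the maximum by a sum. A cube of generation [j] has [(2^j)^n] cells, each contributing
    its mass over [(2^j)^(n-1)]; generation [j] thus gives at most [2^j M], and these powers sum to
    less than [2^(D+1)]. *)
Lemma weight_sum :
  \sum_(q : {ffun 'I_n -> 'I_(2 ^ D)}) weight (pt q) <=
  (2 ^ D.+1)%:R * fine (mu (gbox ((2 ^ D)%:R * h) (fun=> 0%N))).
Proof.
set M := fine _; have M0 : 0 <= M by rewrite fine_ge0.
apply: (@le_trans _ _ (\sum_(q : {ffun 'I_n -> 'I_(2 ^ D)}) \sum_(j < D.+1)
    ancestor_density j (pt q))).
  apply: ler_sum => q _; rewrite /weight.
  apply: bigmax_le => [|j _]; first by apply: sumr_ge0.
  by rewrite (bigD1 j)//= lerDl; apply: sumr_ge0.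
rewrite exchange_big/=.
apply: (@le_trans _ _ (\sum_(j < D.+1) (2 ^ j)%:R * M)); last first.
  rewrite -mulr_suml ler_wpM2r// -natr_sum ler_nat.
  elim: D.+1 => [|d ih]; first by rewrite big_ord0.
  by rewrite big_ord_recr/= expnS mul2n -addnn leq_add2r.
apply: ler_sum => j _.
rewrite (sum_grid (ancestor_density j) (ltnSE (ltn_ord j))).
apply: (@le_trans _ _ (\sum_(b : {ffun 'I_n -> 'I_(2 ^ (D - j))})
    (2 ^ j)%:R * fine (mu (gbox ((2 ^ j)%:R * h) (cube_pt (2 ^ (D - j)) (fun=> 0%N) (pt b)))))).
  apply: ler_sum => b _.
  under eq_bigr do rewrite /ancestor_density ancestor_cube_pt.
  have e : ((2 ^ j) ^ n)%:R = (2 ^ j)%:R * (2 ^ j)%:R ^+ n.-1 :> R.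
    by rewrite -exprS prednK// -natrX.
  have P0 : (2 ^ j)%:R ^+ n.-1 != 0 :> R by rewrite gt_eqF// exprn_gt0.
  by rewrite sumr_const card_ffun !card_ord cube_pt0 -[leLHS]mulr_natl e mulrACA mulfV ?mulr1.
rewrite -mulr_sumr ler_wpM2l//.
apply: le_trans (@mu_gbox_children R n N mu hmu ((2 ^ j)%:R * h) (2 ^ (D - j)) (fun=> 0%N) _ _) _ => //.
  by rewrite expn_gt0.
by rewrite mulrA -natrM -expnD subnK// -ltnS.
Qed.

(** An ancestor of side [s] containing [z] lies in the ball of radius [r = 2 n s] about [z], so its
    mass [m] satisfies [r m / (2 r)^n <= M_1 mu(z)]. Expanding [r^(n-1)] yields the factor
    [2^n (2 n)^(n-1) h^(n-1)]. *)
Lemma weight_maximal p (z : 'rV[R]_n) : gbox h p z ->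
  ((weight p)%:E <= ((2 ^+ n * (2 * n%:R) ^+ n.-1) * h ^+ n.-1)%:E * maximal1 mu z)%E.
Proof.
move=> zp; rewrite /weight; elim/big_ind: _ => [|x y hx hy|j _].
- apply: mule_ge0; first by rewrite lee_fin !mulr_ge0 ?exprn_ge0 ?(ltW h0)// mulr_ge0.
  exact: maximal1_ge0.
- by rewrite /Num.max; case: ifP.
set s := (2 ^ j)%:R * h.
have za : ancestor j p z.
  have -> : ancestor j p = gbox s (fun i => p i %/ 2 ^ j)%N by [].
  have m0 : (0 < 2 ^ j)%N by rewrite expn_gt0.
  apply: (@gbox_child R n N h (2 ^ j) _ (fun i => p i %% 2 ^ j)%N h0) => [i|].
    by rewrite ltn_mod.
  rewrite (_ : cube_pt _ _ _ = p)//; apply/funext => i.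
  by rewrite /cube_pt mulnC -divn_eq.
(* Two points of the ancestor are at Euclidean distance at most [n s]; the factor 2 gives the strict
   inequality of an open ball. *)
pose r := 2 * n%:R * s.
have r0 : 0 < r by rewrite !mulr_gt0// ltr0n.
have sub : ancestor j p `<=` eball z r.
  move=> y ya; rewrite /eball/=; apply: le_lt_trans (enorm_le _) _.
  apply: (@le_lt_trans _ _ (n%:R * s)).
    by rewrite ler_wpM2l// ltW// (gbox_dist (side0 j) za ya).
  have ns0 : 0 < n%:R * s by rewrite mulr_gt0 ?ltr0n ?side0.
  by rewrite /r -(mulrA 2); lra.
have muE : mu (ancestor j p) = (fine (mu (ancestor j p)))%:E.
  by rewrite fineK//; apply: (mu_gbox_fin N hmu); exact: side0.
set m := fine (mu (ancestor j p)) in muE.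
have m0 : 0 <= m by rewrite fine_ge0.
have rR : 0 < (2 * r) ^+ n by rewrite exprn_gt0// mulr_gt0.
have maxE : ((r * m / (2 * r) ^+ n)%:E <= maximal1 mu z)%E.
  apply: (@le_trans _ _ (r%:E * mu (eball z r) / lebesgueRV R n (eball z r))%E).
    rewrite !EFinM; apply: lee_pmul => //.
    - by rewrite mule_ge0 ?lee_fin// ltW.
    - by rewrite lee_fin invr_ge0 ltW.
    - apply: lee_pmul; rewrite ?lee_fin ?(ltW r0)// -muE.
      by apply: le_measure => //; rewrite inE; [exact: measurable_gbox|exact: measurable_eball].
    have -> : (((2 * r) ^+ n)^-1)%:E = (((2 * r) ^+ n)%:E)^-1%E by rewrite inver gt_eqF.
    by rewrite lee_pV2 ?inE ?lee_fin ?(ltW rR)//; exact: lebesgue_eball_le.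
  by apply: ereal_sup_ubound; exists r => //=; rewrite in_itv/= r0.
apply: le_trans (lee_wpmul2l _ maxE); last by rewrite lee_fin !mulr_ge0 ?exprn_ge0 ?(ltW h0)// mulr_ge0.
rewrite -EFinM lee_fin /ancestor_density -/m le_eqVlt; apply/orP; left; apply/eqP.
have e : n = n.-1.+1 by rewrite prednK.
have -> : (2 * r) ^+ n = 2 ^+ n * (r * r ^+ n.-1) by rewrite exprMn -exprS -e.
have -> : r ^+ n.-1 = (2 * n%:R) ^+ n.-1 * ((2 ^ j)%:R ^+ n.-1 * h ^+ n.-1).
  by rewrite /r /s !exprMn.
have x1 : 2 ^+ n != 0 :> R by rewrite gt_eqF// exprn_gt0.
have x2 : (2 * n%:R) ^+ n.-1 != 0 :> R by rewrite gt_eqF// exprn_gt0// mulr_gt0// ltr0n.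
have x3 : (2 ^ j)%:R ^+ n.-1 != 0 :> R by rewrite gt_eqF// exprn_gt0.
have x4 : h ^+ n.-1 != 0 by rewrite gt_eqF// exprn_gt0.
have x5 : r != 0 by rewrite gt_eqF.
by field; rewrite x1 x2 x3 x4 x5.
Qed.

End weights.

(** * From the grid to the trace inequality *)

Section integrals.
Context d (T : measurableType d) (R : realType) (mu : {measure set T -> \bar R}).

(* Applied with [g] involving [maximal1 mu], whose measurability is not proved
   here; this rules out [ge0_le_integral]. *)
Lemma ge0_le_integral_setT (f g : T -> \bar R) :
  (forall x, 0 <= f x)%E -> (forall x, f x <= g x)%E ->
  (\int[mu]_x f x <= \int[mu]_x g x)%E.
Proof.
move=> f0 fg; have g0 x : (0 <= g x)%E by exact: le_trans (f0 x) (fg x).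
rewrite !ge0_integralTE//; apply: le_ereal_sup => _ [s sf <-].
by exists s => // x; apply: le_trans (sf x) (fg x).
Qed.

Lemma integral_step (Q : finType) (F : Q -> set T) (c : Q -> R) :
  (forall q, measurable (F q)) -> (forall q, 0 <= c q) ->
  (\int[mu]_x (\sum_q c q * \1_(F q) x)%:E = \sum_q (c q)%:E * mu (F q))%E.
Proof.
move=> mF c0; under eq_integral do rewrite -sumEFin.
rewrite ge0_integral_sum//; last 2 first.
- by move=> q; apply/measurable_EFinP; apply: measurable_funM => //; exact: measurable_indic.
- by move=> q x _; rewrite lee_fin mulr_ge0.
apply: eq_bigr => q _; under eq_integral do rewrite EFinM.
rewrite ge0_integralZl ?lee_fin//; last first.
  by apply/measurable_EFinP; exact: measurable_indic.
by rewrite integral_indic// setIT.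
Qed.

End integrals.

(** * The truncated inequality at a fixed mesh *)

Section truncation.
Context {R : realType} {n : nat}.
Hypothesis n0 : (0 < n)%N.
Variable mu : {measure set (borelRV R n) -> \bar R}.
Hypothesis hmu : locally_finite_measure mu.
Variables (u G : 'rV[R]_n -> R).
Hypothesis regu : locally_C1_decaying u.
Hypothesis uG : forall i x, `|partial i u x| <= G x.

Definition weight_constant : R := 2 ^+ n * (2 * n%:R) ^+ n.-1.

(** [2^(n+1)] comes from the grid inequality, [n] from bounding the sum of the partial derivatives
    by [n] times [G], and the rest from comparing cubes with balls. *)
Definition trace_constant : R := 2 ^+ n.+1 * (n%:R * weight_constant).

Let reg_continuous (g : 'rV[R]_n -> R) :
  (forall N e : R, 0 < N -> 0 < e -> exists2 d : R, 0 < d &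
        forall x y, `|x| < N -> `|y| < N -> `|x - y| < d -> `|g x - g y| <= e) ->
  continuous g.
Proof.
move=> rg x; apply/(@cvgrPdist_le _ _ _ (nbhs x) (nbhs_filter x)) => e e0.
have N0 : 0 < `|x| + 1 by rewrite ltr_wpDl.
have [d d0 gd] := rg _ _ N0 e0.
have d1 : 0 < Num.min d 1 by rewrite lt_min d0 ltr01.
apply/nbhs_ballP; exists (Num.min d 1) => //= y.
rewrite -ball_normE /ball_/= lt_min => /andP[xy xy1].
apply: gd => //; first by rewrite ltrDl.
by have := ler_normD (y - x) x; rewrite subrK distrC; lra.
Qed.

Lemma continuous_reg : continuous u.
Proof.
apply: reg_continuous => N e N0 e0; have [_ /(_ N e N0 e0)[d d0 h] _] := regu.
by exists d => // x y xN yN xy; have [] := h x y xN yN xy.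
Qed.

Lemma continuous_partial_reg i : continuous (partial i u).
Proof.
apply: reg_continuous => N e N0 e0; have [_ /(_ N e N0 e0)[d d0 h] _] := regu.
by exists d => // x y xN yN xy; have [_] := h x y xN yN xy.
Qed.

Let max0_lip (x y : R) : `|Num.max 0 x - Num.max 0 y| <= `|x - y|.
Proof.
have [x0|x0] := leP 0 x; have [y0|y0] := leP 0 y => //.
- by rewrite !ger0_norm; lra.
- by rewrite !ler0_norm; lra.
- by rewrite subrr normr0.
Qed.

Lemma scale_choice (N d : R) : 0 < N -> 0 < d ->
  exists2 D : nat, (0 < D)%N & 2 * (4 * N / (2 ^ D)%:R) < d.
Proof.
move=> N0 d0; exists (Num.bound (8 * N / d)).+1 => //.
have := @archi_boundP R (8 * N / d); rewrite divr_ge0 ?mulr_ge0 ?(ltW N0) ?(ltW d0)//.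
move=> /(_ isT); set b := Num.bound _ => hb.
have b2 : b%:R <= (2 ^ b.+1)%:R :> R.
  by rewrite ler_nat (leq_trans (ltnW (ltn_expl b (ltnSn 1))))// leq_exp2l.
have p0 : 0 < (2 ^ b.+1)%:R :> R by rewrite ltr0n expn_gt0.
have -> : 2 * (4 * N / (2 ^ b.+1)%:R) = 8 * N / (2 ^ b.+1)%:R by ring.
rewrite ltr_pdivrMr// [d * _]mulrC -ltr_pdivrMr//.
exact: lt_le_trans hb b2.
Qed.

Section scale.
Variables (N e eta : R) (D : nat).
Hypotheses (N0 : 0 < N) (e0 : 0 < e) (eta0 : 0 < eta) (D0 : (0 < D)%N).
Hypothesis uN : forall x, N <= `|x| -> `|u x| <= e.
(** The grid fills [[-N, 3N)^n], twice as wide as the box of radius [N]: a node outside the corner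
    child has a coordinate at least [N], so the truncated function satisfies the support condition
    of [sobolev]. *)
Let h := 4 * N / (2 ^ D)%:R.
(** Nodes have norm at most [3 N] and [h <= 2 N], so cells and mean value points stay within [6 N].
    Two such points attached to the same node are less than [2 * h] apart. *)
Hypothesis osc : forall x y, `|x| < 6 * N -> `|y| < 6 * N -> `|x - y| < 2 * h ->
  `|u x - u y| <= e /\ forall i, `|partial i u x - partial i u y| <= eta.

Let a p : R := Num.max 0 (`|u (node N h p)| - e).
Let jump p i : R := u (node N h (succ_at i p)) - u (node N h p).
Let b p i : R := Num.max 0 (`|jump p i| / h - eta).
Let w := weight N h D mu.
Let cell p : set (borelRV R n) := gbox N h p.

Let pow0 : 0 < (2 ^ D)%:R :> R.
Proof. by rewrite ltr0n expn_gt0. Qed.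

Let h0 : 0 < h.
Proof. by rewrite divr_gt0// mulr_gt0. Qed.

Let hD : (2 ^ D)%:R * h = 4 * N.
Proof. by rewrite /h mulrC divfK// gt_eqF. Qed.

Let h2N : h <= 2 * N.
Proof.
have : 2 <= (2 ^ D)%:R :> R by rewrite ler_nat -[X in (X <= _)%N]expn1 leq_exp2l.
by have := h0; move: hD; nra.
Qed.

Let a_ge0 p : 0 <= a p. Proof. by rewrite le_max lexx. Qed.
Let b_ge0 p i : 0 <= b p i. Proof. by rewrite le_max lexx. Qed.

Let a_supp p i : (2 ^ D.-1 <= p i)%N -> a p = 0.
Proof.
move=> pi; apply/max_idPl; rewrite subr_le0; apply: uN.
apply: le_trans (coord_le_norm _ i); apply: le_trans (ler_norm _); rewrite mxE.
have : h * (2 ^ D.-1)%:R <= h * (p i)%:R by rewrite ler_pM2l// ler_nat.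
have : 2 * (2 ^ D.-1)%:R = (2 ^ D)%:R :> R by rewrite -natrM -expnS prednK.
by move: hD; nra.
Qed.

Let grad_a p : grad1 a p <= h * \sum_i b p i + h * (n%:R * eta).
Proof.
have -> : n%:R * eta = \sum_(i < n) eta by rewrite sumr_const card_ord mulr_natl.
rewrite -mulrDr -big_split mulr_sumr; apply: ler_sum => i _ /=.
apply: (@le_trans _ _ `|jump p i|).
  apply: le_trans (max0_lip _ _) _.
  by rewrite opprB addrA subrK; exact: ler_dist_dist.
by rewrite mulrC -ler_pdivrMr// -lerBlDr le_max lexx orbT.
Qed.

Let node_box (q : {ffun 'I_n -> 'I_(2 ^ D)}) : `|node N h (pt q)| <= 3 * N.
Proof.
apply: rV_norm_le => [|i]; first by rewrite mulr_ge0 ?(ltW N0).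
rewrite mxE /pt; set t := (q i)%:R : R.
have t0 : 0 <= h * t by rewrite mulr_ge0 ?(ltW h0).
have t1 : h * t <= 4 * N by rewrite -hD mulrC ler_wpM2r ?(ltW h0)// ler_nat ltnW.
by rewrite ler_norml; apply/andP; split; move: N0; lra.
Qed.

(** The quotient is a value of the partial derivative at a point within [h] of the node; subtracting
    [eta] pays for moving from there to an arbitrary [z] in the cell. *)
Let b_le (q : {ffun 'I_n -> 'I_(2 ^ D)}) i z : cell (pt q) z -> b (pt q) i <= G z.
Proof.
move=> zq; rewrite ge_max (le_trans (normr_ge0 _) (uG i z))/=.
have [dif _ _] := regu.
have [y yx E] := mean_value_partial (@continuous_partial_reg i) (dif i) (node N h (pt q)) h.
rewrite /jump node_succ_at E normrM (gtr0_norm h0) mulrAC mulfV ?gt_eqF// mul1r.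
rewrite (gtr0_norm h0) in yx.
have nz := gbox_dist h0 (node_gbox N (pt q) h0) zq.
have nb := node_box q; set x := node N h (pt q) in yx nz nb.
have zN : `|z| < 6 * N.
  have := ler_normB x (x - z); rewrite opprB addrC subrK; move: N0 h2N; lra.
have yN : `|y| < 6 * N.
  have := ler_normD (y - x) x; rewrite subrK; move: N0 h2N; lra.
have yz : `|y - z| < 2 * h.
  have := ler_normD (y - x) (x - z); rewrite addrA subrK; lra.
have [_ /(_ i) oz] := osc yN zN yz.
have := ler_normD (partial i u y - partial i u z) (partial i u z); rewrite subrK.
by have := uG i z; lra.
Qed.

(** One [e] is already in [a]; the other pays for replacing [u x] by its value at the node of the
    cell. For [|x| >= N] the left integrand is 0. *)
Let mu_trunc : (\int[mu]_x (Num.max 0 (`|u x| - 2 * e))%:E <=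
  (\sum_(q : {ffun 'I_n -> 'I_(2 ^ D)}) fine (mu (cell (pt q))) * a (pt q))%:E)%E.
Proof.
rewrite -sumEFin (eq_bigr (fun q : {ffun 'I_n -> 'I_(2 ^ D)} =>
  (a (pt q))%:E * mu (cell (pt q)))%E); last first.
  by move=> q _; rewrite EFinM fineK ?(mu_gbox_fin N hmu)// muleC.
rewrite -(integral_step mu) //; last by move=> q; exact: measurable_gbox.
apply: ge0_le_integral_setT => x; first by rewrite lee_fin le_max lexx.
have sum0 (P : pred {ffun 'I_n -> 'I_(2 ^ D)}) :
  0 <= \sum_(q | P q) a (pt q) * \1_(cell (pt q)) x :> R.
  by apply: sumr_ge0 => q _; rewrite mulr_ge0.
rewrite lee_fin; have [xN|xN] := leP N `|x|.
  apply: (@le_trans _ _ 0); last exact: (sum0 xpredT).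
  by rewrite ge_max lexx/=; have := uN xN; move: e0; lra.
have [|q xq] := @gbox_cover R n N h (2 ^ D) x h0.
  move=> i; rewrite hD; have := le_lt_trans (coord_le_norm x i) xN.
  by rewrite ltr_norml => /andP[x1 x2]; apply/andP; split; move: N0; lra.
rewrite (bigD1 q)//= indicE mem_set// mulr1; apply: ler_wpDr; first exact: sum0.
rewrite ge_max a_ge0/=; apply: (@le_trans _ _ (`|u (node N h (pt q))| - e)); last first.
  by rewrite le_max lexx orbT.
have nz := gbox_dist h0 (node_gbox N (pt q) h0) xq.
have nb := node_box q.
have xy : `|x - node N h (pt q)| < 2 * h by rewrite distrC; move: h0 nz; lra.
have [|||ox _] := osc (x := x) (y := node N h (pt q)) => //; try (move: N0; lra).
have := ler_normD (u x - u (node N h (pt q))) (u (node N h (pt q))).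
rewrite subrK; lra.
Qed.

Let wc0 : 0 < weight_constant.
Proof. by rewrite mulr_gt0 ?exprn_gt0// mulr_gt0// ltr0n. Qed.

Let G_ge0 z : 0 <= G z.
Proof. exact: le_trans (normr_ge0 _) (uG (Ordinal n0) z). Qed.

Let H : R := h ^+ n.-1.

Let H0 : 0 < H. Proof. exact: exprn_gt0. Qed.

(** The height on a cell of a step function below [G * maximal1 mu]: the mean of the [b] is at most
    [G], and the normalised weight is at most the maximal function. *)
Let c (q : {ffun 'I_n -> 'I_(2 ^ D)}) : R :=
  (\sum_i b (pt q) i) / n%:R * (w (pt q) / (weight_constant * H)).

Let c_ge0 q : 0 <= c q.
Proof.
have w0 : 0 <= w (pt q) by exact: weight_ge0.
have k0 : 0 <= weight_constant * H by rewrite mulr_ge0 ?(ltW wc0) ?(ltW H0).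
by rewrite mulr_ge0// divr_ge0// sumr_ge0.
Qed.

Let c_le (q : {ffun 'I_n -> 'I_(2 ^ D)}) z : cell (pt q) z ->
  ((c q)%:E <= (G z)%:E * maximal1 mu z)%E.
Proof.
move=> zq; rewrite EFinM; apply: lee_pmul; rewrite ?lee_fin.
- by rewrite divr_ge0// sumr_ge0.
- by rewrite divr_ge0 ?weight_ge0// mulr_ge0 ?(ltW wc0) ?(ltW H0).
- rewrite ler_pdivrMr ?ltr0n//.
  rewrite (_ : G z * n%:R = \sum_(i < n) G z); last by rewrite sumr_const card_ord mulr_natr.
  by apply: ler_sum => i _; exact: b_le.
have k0 : 0 < weight_constant * H by rewrite mulr_gt0.
have k1 : (0 <= ((weight_constant * H)^-1)%:E)%E by rewrite lee_fin invr_ge0 ltW.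
have := lee_wpmul2l k1 (weight_maximal n0 D h0 hmu zq).
rewrite -/weight_constant -/H -/w muleA -!EFinM mulVf ?gt_eqF// mul1e.
by rewrite mulrC.
Qed.

(** A cell has volume [h^n = h * H]; the factor [H] cancels the normalisation in [c] and leaves the
    [h] of the discrete gradient. *)
Let main_term :
  ((h * \sum_(q : {ffun 'I_n -> 'I_(2 ^ D)}) w (pt q) * \sum_i b (pt q) i)%:E <=
   (n%:R * weight_constant)%:E * \int[lebesgueRV R n]_x ((G x)%:E * maximal1 mu x))%E.
Proof.
apply: (@le_trans _ _ ((n%:R * weight_constant)%:E *
    \int[lebesgueRV R n]_x (\sum_q c q * \1_(cell (pt q)) x)%:E)%E).
  rewrite (integral_step _ (fun q => measurable_gbox N h (pt q)) c_ge0).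
  rewrite (eq_bigr (fun q => (c q * h ^+ n)%:E)); last first.
    by move=> q _; rewrite [RHS]EFinM; congr (_ * _)%E; exact: lebesgue_gbox.
  rewrite sumEFin -EFinM lee_fin !mulr_sumr; apply: ler_sum => q _.
  rewrite le_eqVlt; apply/orP; left; apply/eqP; rewrite /c.
  have -> : h ^+ n = h * H by rewrite /H -exprS prednK.
  have x1 : n%:R != 0 :> R by rewrite pnatr_eq0 -lt0n.
  have x2 : weight_constant != 0 by rewrite gt_eqF.
  have x3 : H != 0 by rewrite gt_eqF.
  by field; rewrite x1 x2 x3.
apply: lee_wpmul2l; first by rewrite lee_fin mulr_ge0 ?(ltW wc0).
apply: ge0_le_integral_setT => x.
  by rewrite lee_fin; apply: sumr_ge0 => q _; rewrite mulr_ge0.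
have [[q xq]|nq] := pselect (exists q : {ffun 'I_n -> 'I_(2 ^ D)}, cell (pt q) x).
  rewrite (bigD1 q)//= big1 => [|r rq].
    by rewrite addr0 indicE mem_set// mulr1; exact: c_le.
  rewrite indicE memNset ?mulr0// => xr; move/eqP: rq; apply.
  apply/ffunP => i; apply: val_inj.
  by have /(congr1 (@^~ i)) := gbox_inj h0 xr xq.
rewrite big1 => [|q _]; first by rewrite mule_ge0 ?maximal1_ge0// lee_fin.
by rewrite indicE memNset ?mulr0// => xq; apply: nq; exists q.
Qed.

Lemma scale_bound :
  (\int[mu]_x (Num.max 0 (`|u x| - 2 * e))%:E <=
   trace_constant%:E * \int[lebesgueRV R n]_x ((G x)%:E * maximal1 mu x) +
   (eta * (2 ^+ n.+1 * (n%:R * (8 * N * fine (mu (gbox N (4 * N) (fun=> 0%N)))))))%:E)%E.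
Proof.
apply: le_trans mu_trunc _.
have S := @sobolev R n (fun p => fine (mu (cell p))) w D n0 _ _ _ a D0 a_ge0 a_supp.
apply: (@le_trans _ _ (2 ^+ n.+1 * \sum_(q : {ffun 'I_n -> 'I_(2 ^ D)}) w (pt q) * grad1 a (pt q))%:E).
  rewrite lee_fin; apply: S => [p|p|j k q jD].
  - by rewrite fine_ge0.
  - exact: weight_ge0.
  - exact: weight_frostman.
set M := fine _.
have mt := main_term.
set J := (\int[_]_x _)%E in mt *.
set W := \sum_(q : {ffun 'I_n -> 'I_(2 ^ D)}) w (pt q).
set B := \sum_(q : {ffun 'I_n -> 'I_(2 ^ D)}) w (pt q) * \sum_i b (pt q) i in mt *.
(* The weights sum to at most [2^(D+1) M] and [2^D h = 4 N], so this bound does not involve the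
   mesh. *)
have hW : h * W <= 8 * N * M.
  have := weight_sum n0 N D h0 hmu; rewrite -/w -/W hD -/M => WM.
  have := ler_wpM2l (ltW h0) WM; move/le_trans; apply.
  have e1 : (2 ^ D.+1)%:R = 2 * (2 ^ D)%:R :> R by rewrite expnS natrM.
  have e2 : h * (2 * (2 ^ D)%:R * M) = 2 * ((2 ^ D)%:R * h) * M by ring.
  by rewrite e1 e2 hD le_eqVlt; apply/orP; left; apply/eqP; ring.
apply: (@le_trans _ _ ((2 ^+ n.+1 * (h * B))%:E + (2 ^+ n.+1 * (n%:R * eta * (h * W)))%:E)%E).
  rewrite -EFinD lee_fin -mulrDr ler_pM2l ?exprn_gt0//.
  rewrite mulr_sumr !mulr_sumr -big_split; apply: ler_sum => q _ /=.
  apply: le_trans (ler_wpM2l (weight_ge0 _ _ _ _ _) (grad_a _)) _.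
  by rewrite le_eqVlt; apply/orP; left; apply/eqP; rewrite -/w; ring.
apply: leeD.
  rewrite /trace_constant EFinM [X in (X * J)%E]EFinM -muleA.
  by apply: lee_wpmul2l => //; rewrite lee_fin exprn_ge0.
rewrite lee_fin.
have : n%:R * eta * (h * W) <= n%:R * eta * (8 * N * M).
  by apply: ler_wpM2l => //; rewrite mulr_ge0 ?(ltW eta0).
have : 0 < 2 ^+ n.+1 :> R by rewrite exprn_gt0.
by move=> p1 p2; have := ler_wpM2l (ltW p1) p2; lra.
Qed.

End scale.
End truncation.

(** * Removal of the mesh and of the truncation *)

Section trace.
Context {R : realType} {n : nat}.
Hypothesis n0 : (0 < n)%N.
Variable mu : {measure set (borelRV R n) -> \bar R}.
Hypothesis hmu : locally_finite_measure mu.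
Variables (u G : 'rV[R]_n -> R).
Hypothesis regu : locally_C1_decaying u.
Hypothesis uG : forall i x, `|partial i u x| <= G x.
Local Notation J := (\int[lebesgueRV R n]_x ((G x)%:E * maximal1 mu x))%E.

Lemma truncated_bound (e : R) : 0 < e ->
  (\int[mu]_x (Num.max 0 (`|u x| - 2 * e))%:E <= (@trace_constant R n)%:E * J)%E.
Proof.
move=> e0; have [_ reg /(_ e e0)[N N0 uN]] := regu.
(* The order of choices matters: [e] determines [N], hence [K]; then [eta] is taken small against
   [K], and only then is the mesh chosen from the modulus of continuity. *)
pose K : R := 2 ^+ n.+1 * (n%:R * (8 * N * fine (mu (gbox N (4 * N) (fun=> 0%N))))).
have K0 : 0 <= K.
  by rewrite mulr_ge0 ?exprn_ge0// mulr_ge0// mulr_ge0 ?fine_ge0// mulr_ge0// ltW.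
apply/lee_addgt0Pr => e' e'0.
have K1 : 0 < K + 1 by rewrite ltr_wpDl.
have eta0 : 0 < e' / (K + 1) by rewrite divr_gt0.
have m0 : 0 < Num.min e (e' / (K + 1)) by rewrite lt_min e0.
have N6 : 0 < 6 * N by rewrite mulr_gt0.
have [d d0 ud] := reg _ _ N6 m0.
have [D D0 hd] := scale_choice N0 d0.
apply: (@le_trans _ _ ((@trace_constant R n)%:E * J + (e' / (K + 1) * K)%:E)%E).
  apply: (scale_bound n0 hmu regu uG N0 e0 eta0 D0 uN) => x y xN yN xy.
  have [|h1 h2] := ud x y xN yN; first exact: lt_trans hd.
  split; first by apply: le_trans h1 _; rewrite ge_min lexx.
  by move=> i; apply: le_trans (h2 i) _; rewrite ge_min lexx orbT.
apply: leeD => //; rewrite lee_fin mulrAC ler_pdivrMr// ler_wpM2l ?(ltW e'0)//.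
by rewrite lerDl.
Qed.

(** Monotone convergence along [e = 1 / (k + 1)]: the right side of [truncated_bound] is the same
    for all [e]. *)
Lemma trace_inequality :
  (\int[mu]_x `|u x|%:E <= (@trace_constant R n)%:E * J)%E.
Proof.
pose g (k : nat) (x : borelRV R n) : \bar R :=
  (Num.max 0 (`|u x| - 2 * k.+1%:R^-1))%:E.
have mg k : measurable_fun setT (g k).
  apply/measurable_EFinP; apply: measurable_maxr => //.
  apply: measurable_funB => //; apply: measurableT_comp => //.
  exact: continuous_measurableRV (continuous_reg regu).
have g0 k x : setT x -> (0 <= g k x)%E by rewrite lee_fin le_max lexx.
have gnd x : setT x -> nondecreasing_seq (g ^~ x).
  move=> _ k l kl; rewrite lee_fin ge_max !le_max lexx/=; apply/orP; right.
  rewrite lerD2l lerN2 ler_pM2l// lef_pV2 ?posrE// ler_nat//.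
have glim x : limn (g ^~ x) = `|u x|%:E.
  apply/cvg_lim => //; apply: cvg_EFin; first exact: nearW.
  apply/cvgrPdist_le => e e0; near=> k.
  have ke : k.+1%:R^-1 < e / 2 by near: k; apply: (near_infty_natSinv_lt (PosNum (divr_gt0 e0 (ltr0n _ 2)))).
  have k0 : 0 < k.+1%:R^-1 :> R by rewrite invr_gt0.
  have := normr_ge0 (u x); rewrite /g /=.
  set t := `|u x|; set s := k.+1%:R^-1 in ke k0 *.
  have [ts|ts] := leP 0 (t - 2 * s) => t0.
    by rewrite opprB addrCA subrr addr0 ger0_norm; lra.
  by rewrite subr0 ger0_norm//; lra.
rewrite (eq_integral (fun x => limn (g ^~ x))); last by move=> x _; rewrite glim.
rewrite monotone_convergence//; apply: lime_le.
  apply: ereal_nondecreasing_is_cvgn => k l kl.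
  by apply: ge0_le_integral_setT => x; [exact: g0|exact: gnd].
by apply: nearW => k; apply: truncated_bound; rewrite invr_gt0.
Unshelve. all: by end_near. Qed.

End trace.

Theorem theorem2p8 (R : realType) (n : nat) (hn : (2 <= n)%N)
    (mu : {measure set (borelRV R n) -> \bar R})
    (hmu : locally_finite_measure mu) :
  exists C : R, 0 < C /\
    forall f : 'rV[R]_n -> R, test_function f ->
      (\int[mu]_x `|riesz_potential 1 f x|%:E <=
       C%:E * \int[lebesgueRV R n]_x
                ((enorm (riesz_transform f x))%:E * maximal1 mu x))%E.
Proof.
have n0 : (0 < n)%N by exact: leq_trans hn.
exists (@trace_constant R n); split.
  by rewrite mulr_gt0 ?exprn_gt0// mulr_gt0 ?ltr0n// mulr_gt0 ?exprn_gt0// mulr_gt0// ltr0n.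
move=> f tf; apply: trace_inequality (potential_regular hn tf) _ => // i x.
(* Here [G] is the Euclidean norm of the transform, whose coordinates are minus the partial
   derivatives of the potential. *)
by apply: le_trans (coord_le_enorm _ i); rewrite /riesz_transform !mxE normrN.
Qed.
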